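(* Let $(M,F)$ be a forward geodesically complete $n$-dimensional Finsler manifold. If $(M,F)$ admits a Mobius mapping, then the indicatrix $S=\{y\in T_{x_0}M: F(x_0,y)=1\}$, $x_0\in M$, is conformally diffeomorphic to the Euclidean sphere $S^{n-1}$ in $\mathbb R^n$.
   Context: Finsler manifold: $M$ is a connected smooth $n$-dimensional manifold, $TM_0$ the bundle of nonzero tangent vectors, $\pi:TM_0\to M$ the projection, $\pi^*TM$ the pull-back bundle. A Finsler structure is $F:TM\to[0,\infty)$, smooth on $TM_0$, with $F(x,\lambda y)=\lambda F(x,y)$ for all $\lambda>0$, and $g_{ij}(x,y)=\frac12\frac{\partial^2F^2}{\partial y^i\partial y^j}$ positive definite on $TM_0$; $g$ is an inner product on $\pi^*TM$, with inverse $g^{ij}$. The indicatrix at $x_0$ is regarded as a Riemannian hypersurface of $T_{x_0}M\setminus\{0\}$ with the metric $g_{ij}(x_0,y)dy^idy^j$. $(M,F)$ is forward geodesically complete if every geodesic defined on an open interval $(a,b)$ extends to a geodesic on $(a,\infty)$. Cartan connection: $G^i=\frac14 g^{il}\{[F^2]_{x^ky^l}y^k-[F^2]_{x^l}\}$, $G^j_i=\partial G^j/\partial y^i$, $\delta_i=\frac{\delta}{\delta x^i}=\frac{\partial}{\partial x^i}-G^j_i\frac{\partial}{\partial y^j}$, $\Gamma^i_{jk}=\frac12g^{il}(\delta_jg_{lk}+\delta_kg_{jl}-\delta_lg_{jk})$, $C^i_{jk}=\frac12g^{il}\frac{\partial g_{jk}}{\partial y^l}$. The Cartan connection ${}^c\nabla$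 is the linear connection on $\pi^*TM$ with ${}^c\nabla_{\delta_k}\frac{\partial}{\partial x^j}=\Gamma^i_{jk}\frac{\partial}{\partial x^i}$ and ${}^c\nabla_{\partial/\partial y^k}\frac{\partial}{\partial x^j}=C^i_{jk}\frac{\partial}{\partial x^i}$. The map $\varrho=\pi_*:TTM_0\to\pi^*TM$ sends $\delta_i\mapsto\frac{\partial}{\partial x^i}$, $\frac{\partial}{\partial y^i}\mapsto0$. Geodesics, parameterized by arc length $s$, satisfy $\frac{d^2x^i}{ds^2}+2G^i(x,\frac{dx}{ds})=0$. For $\varphi\in C^\infty(M)$ with $\varphi_i=\partial\varphi/\partial x^i$: $\nabla\varphi=g^{ij}(x,y)\varphi_j\frac{\partial}{\partial x^i}\in\Gamma(\pi^*TM)$, $\|\mathrm{grad}\,\varphi\|^2=g^{ij}\varphi_i\varphi_j$, and $\Delta\varphi=g^{ij}\big(\frac{\partial^2\varphi}{\partial x^i\partial x^j}-(\Gamma^k_{ij}+C^k_{ij})\varphi_k\big)$. Mobius mappings: a diffeomorphism $f:(M,F)\to(M,\bar F)$, with $\bar F$ another Finsler structure on $M$, is conformal if $f^*\bar F=e^{\varphi}F$ for some smooth $\varphi:M\to\mathbb R$, where $(f^*\bar F)(x,y)=\bar F(f(x),df_x(y))$. Its Schwarzian derivative is the linear map on vector fields $\hat X$ on $TM_0$, with values in $\Gamma(\pi^*TM)$, $$S_F(f)\hat X={}^c\nabla_{\hat X}(\nabla\varphi)-g(\nabla\varphi,\varrho\hat X)\nabla\varphi-\tfrac1n\big(\Delta\varphi-\|\mathrm{grad}\,\varphi\|^2\big)\varrho\hat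 X .$$ The conformal map $f$ is a Mobius mapping if $S_F(f)\hat X=0$ for all $\hat X$.
   Formalization: The Mobius mapping is assumed to be non-homothetic (its conformal factor φ is not constant); otherwise the identity map with F̄ = 2F would be a Mobius mapping of every (M,F), and the claim fails, for instance for suitable Minkowski norms on R^n with n ≥ 5. *)

(* Defs.v *)
From HB Require Import structures.
From mathcomp Require Import all_boot all_order all_algebra.
From mathcomp Require Import all_classical all_reals all_analysis.

Set Implicit Arguments.
Unset Strict Implicit.
Unset Printing Implicit Defensive.

Import Order.TTheory GRing.Theory Num.Theory.
Import numFieldNormedType.Exports.

Local Open Scope classical_set_scope.
Local Open Scope ring_scope.

Definition iter_deriv {R : realType} {V W : normedModType R}
    (f : V -> W) (vs : seq V) : V -> W :=
  foldr (fun v g => 'D_v g) f vs.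

(* C^oo on an open set U of a finite-dimensional space V: all iterated
   directional derivatives exist and are continuous at the points of U.  For U
   open this depends only on the values of f on U; U is open at every use. *)
Definition smooth_on {R : realType} {V W : normedModType R}
    (U : set V) (f : V -> W) : Prop :=
  forall (vs : seq V) (x : V), U x ->
    {for x, continuous (iter_deriv f vs)} /\
    (forall v : V, derivable (iter_deriv f vs) x v).

(* A connected smooth n-manifold given by an indexed atlas.  Outside [dom i]
   (resp. outside [chart_map i @` dom i]) the values of [chart_map i] (resp. of
   [param i]) are junk. *)
Record smoothManifold (R : realType) (n : nat) := SmoothManifold {
  carrier :> topologicalType ;
  idx : Type ;
  dom : idx -> set carrier ;
  chart_map : idx -> carrier -> 'rV[R]_n ;
  param : idx -> 'rV[R]_n -> carrier ;
  point_hausdorff : hausdorff_space carrier ;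
  point_second_countable : @second_countable carrier ;
  point_connected : connected [set: carrier] ;
  dom_cover : forall p, exists i, dom i p ;
  dom_open : forall i, open (dom i) ;
  img_open : forall i, open (chart_map i @` dom i) ;
  chartK : forall i p, dom i p -> param i (chart_map i p) = p ;
  chart_continuous :
    forall i p, dom i p -> {for p, continuous (chart_map i)} ;
  param_continuous :
    forall i x, (chart_map i @` dom i) x -> {for x, continuous (param i)} ;
  transition_smooth : forall i j,
    smooth_on (chart_map i @` (dom i `&` dom j)) (chart_map j \o param i)
}.

Section Manifold.
Context {R : realType} {n : nat}.
Implicit Types M N : smoothManifold R n.

Definition img M (i : idx M) : set 'rV[R]_n := chart_map i @` dom i.

Definition smooth_function M (phi : M -> R) : Prop :=
  forall i : idx M, smooth_on (img i) (phi \o param i : _ -> R^o).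

Definition smooth_map M N (f : M -> N) : Prop :=
  continuous f /\
  forall (i : idx M) (j : idx N),
    smooth_on (chart_map i @` (dom i `&` f @^-1` dom j))
              (chart_map j \o f \o param i).

Definition diffeomorphism M N (f : M -> N) : Prop :=
  smooth_map f /\
  exists g : N -> M, smooth_map g /\ cancel f g /\ cancel g f.

Definition smooth_curve M (D : set R) (c : R -> M) : Prop :=
  (forall t, D t -> {for t, continuous c}) /\
  forall i : idx M,
    smooth_on (D `&` c @^-1` dom i : set R^o) (chart_map i \o c : R^o -> _).

End Manifold.

(* Local formulas in one chart: L x y is F(x, y^i d/dx^i), and functions on the
   chart of TM_0 are curried functions of x and y. *)
Section LocalFormulas.
Context {R : realType} {n : nat}.
Notation vec := 'rV[R]_n.
Implicit Types (x y h v : vec) (f : vec -> vec -> R) (L : vec -> vec -> R).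

Definition basis_vec (i : 'I_n) : vec := delta_mx 0 i.

Definition dx (k : 'I_n) f : vec -> vec -> R :=
  fun x y => 'D_(basis_vec k) (fun x' => f x' y : R^o) x.
Definition dy (k : 'I_n) f : vec -> vec -> R :=
  fun x y => 'D_(basis_vec k) (fun y' => f x y' : R^o) y.

Definition sq L : vec -> vec -> R := fun x y => L x y ^+ 2.

Definition g_ L (i j : 'I_n) : vec -> vec -> R :=
  fun x y => 2^-1 * dy i (dy j (sq L)) x y.

Definition ginv L (i j : 'I_n) : vec -> vec -> R :=
  fun x y => invmx (\matrix_(k < n, l < n) g_ L k l x y) i j.

Definition inner L x y (u w : vec) : R :=
  \sum_(i < n) \sum_(j < n) g_ L i j x y * u 0 i * w 0 j.

Definition spray L (i : 'I_n) : vec -> vec -> R := fun x y =>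
  4^-1 * \sum_(l < n) ginv L i l x y *
    ((\sum_(k < n) dy l (dx k (sq L)) x y * y 0 k) - dx l (sq L) x y).

Definition spray_vec L x y : vec := \row_i spray L i x y.

(* Ncoef L j i is G^j_i *)
Definition Ncoef L (j i : 'I_n) : vec -> vec -> R := dy i (spray L j).

Definition delta L (i : 'I_n) f : vec -> vec -> R := fun x y =>
  dx i f x y - \sum_(j < n) Ncoef L j i x y * dy j f x y.

(* Gam L i j k is Gamma^i_jk, and Ccoef L i j k is C^i_jk *)
Definition Gam L (i j k : 'I_n) : vec -> vec -> R := fun x y =>
  2^-1 * \sum_(l < n) ginv L i l x y *
    (delta L j (g_ L l k) x y + delta L k (g_ L j l) x y
     - delta L l (g_ L j k) x y).

Definition Ccoef L (i j k : 'I_n) : vec -> vec -> R := fun x y =>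
  2^-1 * \sum_(l < n) ginv L i l x y * dy l (g_ L j k) x y.

(* The Cartan connection on pi^*TM: derivative at (x,y) of the section
   Z^i d/dx^i along X = h^k delta_k + v^k d/dy^k. *)
Definition cartan L (Z : vec -> vec -> vec) x y h v : vec :=
  \row_i (\sum_(k < n) h 0 k *
            (delta L k (fun x' y' => Z x' y' 0 i) x y
             + \sum_(j < n) Gam L i j k x y * Z x y 0 j)
          + \sum_(k < n) v 0 k *
            (dy k (fun x' y' => Z x' y' 0 i) x y
             + \sum_(j < n) Ccoef L i j k x y * Z x y 0 j)).

Implicit Type phi : vec -> R.

Definition d1 (i : 'I_n) phi : vec -> R := 'D_(basis_vec i) (phi : _ -> R^o).

Definition grad L phi : vec -> vec -> vec := fun x y =>
  \row_i \sum_(j < n) ginv L i j x y * d1 j phi x.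

Definition grad_sqnorm L phi x y : R :=
  \sum_(i < n) \sum_(j < n) ginv L i j x y * d1 i phi x * d1 j phi x.

Definition laplacian L phi x y : R :=
  \sum_(i < n) \sum_(j < n) ginv L i j x y *
    (d1 i (d1 j phi) x
     - \sum_(k < n) (Gam L k i j x y + Ccoef L k i j x y) * d1 k phi x).

(* S_F(f) at (x,y) applied to X = h^k delta_k + v^k d/dy^k; rho(X) = h.  The
   value depends only on X at (x,y), so no vector fields are needed. *)
Definition schwarzian L phi x y h v : vec :=
  cartan L (grad L phi) x y h v
  - inner L x y (grad L phi x y) h *: grad L phi x y
  - (n%:R^-1 * (laplacian L phi x y - grad_sqnorm L phi x y)) *: h.

End LocalFormulas.

(* A function on TM is given by its chart expressions [fs i x y], which agree
   on overlaps along the differentials of the transition maps. *)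
Record finslerStructure (R : realType) (n : nat) (M : smoothManifold R n) :=
  FinslerStructure {
  fs :> idx M -> 'rV[R]_n -> 'rV[R]_n -> R ;
  fs_chart_change : forall (i j : idx M) (p : M) (y : 'rV[R]_n),
    dom i p -> dom j p ->
    fs j (chart_map j p) ('D_y (chart_map j \o param i) (chart_map i p))
      = fs i (chart_map i p) y ;
  fs_ge0 : forall i x y, img i x -> 0 <= fs i x y ;
  fs_smooth : forall i,
    smooth_on [set z : 'rV[R]_n * 'rV[R]_n | img i z.1 /\ z.2 != 0]
              (fun z => fs i z.1 z.2 : R^o) ;
  fs_homogeneous : forall i x y (lambda : R), img i x -> 0 < lambda ->
    fs i x (lambda *: y) = lambda * fs i x y ;
  fs_posdef : forall i x y u, img i x -> y != 0 -> u != 0 ->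
    0 < inner (fs i) x y u u
}.

Section Finsler.
Context {R : realType} {n : nat} {M : smoothManifold R n}.
Implicit Types F Fbar : finslerStructure M.

(* Geodesics are parameterized by arc length. *)
Definition geodesic F (D : set R) (c : R -> M) : Prop :=
  smooth_curve D c /\
  forall (t : R) (i : idx M), D t -> dom i (c t) ->
    let x := chart_map i \o c in
    F i (x t) (derive1 x t) = 1 /\
    derive1 (derive1 x) t + 2 *: spray_vec (F i) (x t) (derive1 x t) = 0.

Definition forward_complete F : Prop :=
  forall (a b : R) (c : R -> M), a < b -> geodesic F `]a, b[ c ->
    exists c' : R -> M, geodesic F `]a, +oo[ c' /\
      (forall t, a < t < b -> c' t = c t).

(* f^* Fbar = e^phi F *)
Definition pullback_conformal F Fbar (f : M -> M) (phi : M -> R) : Prop :=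
  forall (i j : idx M) (p : M) (y : 'rV[R]_n), dom i p -> dom j (f p) ->
    Fbar j (chart_map j (f p)) ('D_y (chart_map j \o f \o param i) (chart_map i p))
      = expR (phi p) * F i (chart_map i p) y.

Definition conformal F Fbar (f : M -> M) (phi : M -> R) : Prop :=
  [/\ diffeomorphism f, smooth_function phi & pullback_conformal F Fbar f phi].

Definition mobius F Fbar (f : M -> M) : Prop :=
  exists phi : M -> R, conformal F Fbar f phi /\
    forall (i : idx M) (x y h v : 'rV[R]_n), img i x -> y != 0 ->
      schwarzian (F i) (phi \o param i) x y h v = 0.

Definition homothetic F Fbar (f : M -> M) : Prop :=
  exists c : R, conformal F Fbar f (fun=> c).

(* The indicatrix at x0 and its metric, in the linear coordinates y^i of
   T_{x0}M given by chart i; changing i is a linear isometry. *)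
Definition indicatrix F (i : idx M) (x0 : M) : set 'rV[R]_n :=
  [set y | F i (chart_map i x0) y = 1].

Definition indicatrix_metric F (i : idx M) (x0 : M) :
    'rV[R]_n -> 'rV[R]_n -> 'rV[R]_n -> R :=
  inner (F i) (chart_map i x0).

End Finsler.

Section ConformalDiffeo.
Context {R : realType} {n : nat}.
Notation vec := 'rV[R]_n.

Definition euclid (y u w : vec) : R := \sum_(i < n) u 0 i * w 0 i.

Definition unit_sphere : set vec := [set z | \sum_(i < n) z 0 i ^+ 2 = 1].

(* Velocities at y of the smooth curves contained in A. *)
Definition tangent (A : set vec) (y u : vec) : Prop :=
  exists (c : R -> vec) (e : R),
    [/\ 0 < e, smooth_on (`]- e, e[ : set R^o) (c : R^o -> vec),
        forall t : R, - e < t < e -> A (c t), c 0 = y & derive1 c 0 = u].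

(* A smooth map on an embedded submanifold A of R^n is the restriction of a
   smooth map on an open neighbourhood of A; metrics (depending on the base
   point first) only matter on tangent vectors. *)
Definition conformally_diffeomorphic
    (A : set vec) (gA : vec -> vec -> vec -> R)
    (B : set vec) (gB : vec -> vec -> vec -> R) : Prop :=
  exists (U V : set vec) (h k : vec -> vec) (sigma : vec -> R),
    [/\ [/\ open U, A `<=` U, smooth_on U h & smooth_on U (sigma : _ -> R^o)],
        [/\ open V, B `<=` V & smooth_on V k],
        forall y, A y -> B (h y) /\ k (h y) = y,
        forall z, B z -> A (k z) /\ h (k z) = z &
        forall y u w, A y -> tangent A y u -> tangent A y w ->
          gB (h y) ('D_u h y) ('D_w h y) = expR (sigma y) * gA y u w].

End ConformalDiffeo.

(* Main.v *)
(* The vertical part of the Mobius equation reads D_y X = - C(X) for the gradient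
   X = grad phi, while differentiating g(X) = d phi in the direction of y gives
   D_y X = - 2 C(X).  Hence C(X) = 0 and X does not depend on y, so at a point x
   with d phi <> 0 the tensor g(x, .) is constant along the nonzero direction
   V = X(x).  As g is smooth off the origin and 0-homogeneous,
   g(x, y) = g(x, y / t + V) tends to g(x, V) as t goes to infinity: F(x, .) is
   the norm of a scalar product.  By continuity this persists on the closure of
   the set where d phi <> 0.

   That closure is all of M.  The horizontal part of the equation has the form
   D_h X = l h + O(|h| |X|), so modulo its direction X hardly changes along a
   segment; joining a point q to two points of a ball of radius e on which X
   vanishes shows that X(q) is O(e sup |X|), hence X vanishes on the concentric
   ball of radius 2 e when e is small.  So the set where phi is locally constant
   is open and closed, and it is empty since f is not homothetic.

   The indicatrix is then an ellipsoid, linearly isometric to the round sphere.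
   This needs n >= 2; for n <= 1 the indicatrix has at most two points. *)

Require Import Defs.
From mathcomp Require Import all_boot all_order all_algebra.
From mathcomp Require Import all_classical all_reals all_analysis.
From mathcomp Require Import perm ring lra.

Set Implicit Arguments.
Unset Strict Implicit.
Unset Printing Implicit Defensive.

Import Order.TTheory GRing.Theory Num.Theory.
Import numFieldNormedType.Exports.

Local Open Scope classical_set_scope.
Local Open Scope ring_scope.

(** * Smooth functions and directional derivatives *)

Section Calculus.
Context {R : realType}.
Implicit Types V W : normedModType R.

(** Differentiability of order [k] for scalar functions, peeling off the innermost derivative first.
    Counting orders, instead of listing directions as [smooth_on] does, lets the Leibniz rule close
    an induction. *)
Fixpoint Ck V (k : nat) (U : set V) (f : V -> R^o) : Prop :=
  if k is k'.+1 then
    [/\ forall x, U x -> {for x, continuous f},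
        forall x v, U x -> derivable f x v &
        forall v, Ck k' U ('D_v f)]
  else forall x, U x -> {for x, continuous f}.

Lemma CkS V k (U : set V) f : Ck k.+1 U f -> Ck k U f.
Proof.
elim: k f => [f [] //|k IH f [fc fd fD]].
by split => // v; exact/IH/fD.
Qed.

Lemma smooth_on_deriv V W (U : set V) (f : V -> W) v :
  smooth_on U f -> smooth_on U ('D_v f).
Proof.
move=> sf vs x Ux; have := sf (rcons vs v) x Ux.
by rewrite /iter_deriv foldr_rcons.
Qed.

Lemma smooth_onP V (U : set V) (f : V -> R^o) :
  smooth_on U f <-> forall k, Ck k U f.
Proof.
split=> [sf k|].
  elim: k f sf => [f sf x Ux|k IH f sf]; first by have [] := sf [::] x Ux.
  split=> [x Ux|x v Ux|v]; first by have [] := sf [::] x Ux.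
  - by have [_] := sf [::] x Ux; exact.
  - exact/IH/smooth_on_deriv.
(* The direction differentiated first is the last entry of [vs], hence the induction from the right
   end. *)
move=> fk vs; elim/last_ind: vs f fk => [f fk x Ux|vs v IH f fk x Ux].
  by have [fc fd _] := fk 1%N; split; [exact: fc|move=> v; exact: fd].
rewrite /iter_deriv foldr_rcons; apply: IH => // k.
by have [_ _] := fk k.+1; exact.
Qed.

(** The value of ['D_v f] at a point depends only on the germ of [f] there; since [U] is open,
    agreement on [U] passes to the derivatives of every order. *)
Lemma Ck_eq V k (U : set V) (f g : V -> R^o) : open U ->
  (forall x, U x -> f x = g x) -> Ck k U f -> Ck k U g.
Proof.
move=> oU; elim: k f g => [|k IH] f g fg; last first.
  have fgx x : U x -> \forall y \near x, f y = g y.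
    by move=> Ux; apply: filterS (open_nbhs_nbhs (conj oU Ux)); exact: fg.
  move=> [fc fd fD]; split=> [x Ux|x v Ux|v].
  - apply: cvg_trans (near_eq_cvg (fgx x Ux)) _.
    by rewrite -fg//; exact: fc.
  - exact: near_eq_derivable (fgx x Ux) (fd x v Ux).
  - by apply: IH (fD v) => x Ux; exact/near_eq_derive/fgx.
move=> fc x Ux; apply: cvg_trans (near_eq_cvg _) _; last by rewrite -fg//; exact: fc.
by apply: filterS (open_nbhs_nbhs (conj oU Ux)); exact: fg.
Qed.

Lemma Ck_cst V k (U : set V) (c : R) : Ck k U (fun=> c).
Proof.
elim: k c => [|k IH] c /=; first by move=> x _; exact: cvg_cst.
split=> [x _|x v _|v]; [exact: cvg_cst|exact: derivable_cst|].
suff -> : 'D_v (fun=> c : R^o) = fun _ : V => 0 by [].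
by apply/funext => x; exact: derive_cst.
Qed.

Lemma CkD V k (U : set V) (f g : V -> R^o) : open U ->
  Ck k U f -> Ck k U g -> Ck k U (fun x => f x + g x).
Proof.
move=> oU; elim: k f g => [|k IH] f g /=.
  by move=> fc gc x Ux; apply: cvgD; [exact: fc|exact: gc].
move=> [fc fd fD] [gc gd gD]; split=> [x Ux|x v Ux|v].
- by apply: cvgD; [exact: fc|exact: gc].
- exact: derivableD (fd x v Ux) (gd x v Ux).
- apply: Ck_eq (IH _ _ (fD v) (gD v)) => // x Ux.
  by rewrite -(deriveD (fd x v Ux) (gd x v Ux)).
Qed.

Lemma CkM V k (U : set V) (f g : V -> R^o) : open U ->
  Ck k U f -> Ck k U g -> Ck k U (fun x => f x * g x).
Proof.
move=> oU; elim: k f g => [|k IH] f g.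
  by move=> fc gc x Ux; apply: cvgM; [exact: fc|exact: gc].
move=> hf hg; have [fc fd fD] := hf; have [gc gd gD] := hg.
split=> [x Ux|x v Ux|v].
- by apply: cvgM; [exact: fc|exact: gc].
- exact: derivableM (fd x v Ux) (gd x v Ux).
- apply: Ck_eq (CkD oU (IH _ _ (CkS hf) (gD v)) (IH _ _ (CkS hg) (fD v))) => // x Ux.
  by rewrite -(deriveM (fd x v Ux) (gd x v Ux)).
Qed.

(** The derivative of 1/f is -(1/f)^2 Df, so knowing 1/f at order k gives order k+1. *)
Lemma CkV V k (U : set V) (f : V -> R^o) : open U ->
  (forall x, U x -> f x != 0) -> Ck k U f -> Ck k U (fun x => (f x)^-1).
Proof.
move=> oU f0; elim: k => [|k IH].
  by move=> fc x Ux; apply: cvgV; [exact: f0|exact: fc].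
move=> hf; have [fc fd fD] := hf.
split=> [x Ux|x v Ux|v].
- by apply: cvgV; [exact: f0|exact: fc].
- exact: derivableV (f0 x Ux) (fd x v Ux).
- have Vk := IH (CkS hf).
  apply: Ck_eq (CkM oU (CkM oU (Ck_cst k U (-1)) (CkM oU Vk Vk)) (fD v)) => // x Ux.
  rewrite (deriveV (f0 x Ux) (fd x v Ux)).
  by rewrite /GRing.scale/= expr2 invfM; ring.
Qed.

(** Here [i] is affine with linear part [l]: the difference quotient of [f \o i] along [v] is
    literally that of [f] along [l v]. This covers the projections and slices of a product. *)
Lemma Ck_comp V V' k (U : set V) (U' : set V') (i : V' -> V) (l : V' -> V)
    (f : V -> R^o) : continuous i ->
  (forall (h : R) v x, i (h *: v + x) = h *: l v + i x) ->
  (forall x, U' x -> U (i x)) -> Ck k U f -> Ck k U' (f \o i).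
Proof.
move=> ic il iU; elim: k f => [|k IH] f.
  by move=> fc x Ux; apply: continuous_comp; [exact: ic|exact/fc/iU].
move=> [fc fd fD]; split=> [x Ux|x v Ux|v].
- by apply: continuous_comp; [exact: ic|exact/fc/iU].
- have := fd _ (l v) (iU x Ux); rewrite /derivable.
  by under eq_fun do rewrite /= -il.
- suff -> : 'D_v (f \o i : _ -> R^o) = 'D_(l v) f \o i by exact/IH/fD.
  apply/funext => x; rewrite /derive /=.
  by under eq_fun do rewrite /= il.
Qed.

End Calculus.

Section SmoothFunctions.
Context {R : realType} {V : normedModType R}.
Variable U : set V.
Hypothesis oU : open U.
Implicit Types f g : V -> R^o.

Lemma smooth_on_continuous f x : smooth_on U f -> U x -> {for x, continuous f}.
Proof. by move=> sf Ux; have [] := sf [::] x Ux. Qed.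

Lemma smooth_on_derivable f x v : smooth_on U f -> U x -> derivable f x v.
Proof. by move=> sf Ux; have [_] := sf [::] x Ux; exact. Qed.

Lemma smooth_on_eq f g :
  (forall x, U x -> f x = g x) -> smooth_on U f -> smooth_on U g.
Proof. by move=> fg /smooth_onP sf; apply/smooth_onP => k; exact: Ck_eq fg (sf k). Qed.

Lemma smooth_on_cst (c : R) : smooth_on U (fun=> c : R^o).
Proof. by apply/smooth_onP => k; exact: Ck_cst. Qed.

Lemma smooth_onD f g :
  smooth_on U f -> smooth_on U g -> smooth_on U (fun x => f x + g x).
Proof. by move=> /smooth_onP sf /smooth_onP sg; apply/smooth_onP => k; exact: CkD. Qed.

Lemma smooth_onM f g :
  smooth_on U f -> smooth_on U g -> smooth_on U (fun x => f x * g x).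
Proof. by move=> /smooth_onP sf /smooth_onP sg; apply/smooth_onP => k; exact: CkM. Qed.

Lemma smooth_onV f : (forall x, U x -> f x != 0) ->
  smooth_on U f -> smooth_on U (fun x => (f x)^-1).
Proof. by move=> f0 /smooth_onP sf; apply/smooth_onP => k; exact: CkV. Qed.

Lemma smooth_onZ c f : smooth_on U f -> smooth_on U (fun x => c * f x).
Proof. exact: smooth_onM (smooth_on_cst c). Qed.

Lemma smooth_onN f : smooth_on U f -> smooth_on U (fun x => - f x).
Proof.
by move=> sf; apply: smooth_on_eq (smooth_onZ (-1) sf) => x _; rewrite mulN1r.
Qed.

Lemma smooth_onB f g :
  smooth_on U f -> smooth_on U g -> smooth_on U (fun x => f x - g x).
Proof. by move=> sf /smooth_onN; exact: smooth_onD. Qed.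

Lemma smooth_on_sum I (r : seq I) (P : pred I) (f : I -> V -> R^o) :
  (forall i, smooth_on U (f i)) ->
  smooth_on U (fun x => \sum_(i <- r | P i) f i x).
Proof.
move=> sf; elim: r => [|i r IH].
  by apply: smooth_on_eq (smooth_on_cst 0) => x _; rewrite big_nil.
case Pi : (P i).
  by apply: smooth_on_eq (smooth_onD (sf i) IH) => x _; rewrite big_cons Pi.
by apply: smooth_on_eq IH => x _; rewrite big_cons Pi.
Qed.

Lemma smooth_on_prod I (r : seq I) (P : pred I) (f : I -> V -> R^o) :
  (forall i, smooth_on U (f i)) ->
  smooth_on U (fun x => \prod_(i <- r | P i) f i x).
Proof.
move=> sf; elim: r => [|i r IH].
  by apply: smooth_on_eq (smooth_on_cst 1) => x _; rewrite big_nil.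
case Pi : (P i).
  by apply: smooth_on_eq (smooth_onM (sf i) IH) => x _; rewrite big_cons Pi.
by apply: smooth_on_eq IH => x _; rewrite big_cons Pi.
Qed.

Lemma smooth_on_det m (A : V -> 'M[R]_m) :
  (forall i j, smooth_on U (fun x => A x i j : R^o)) ->
  smooth_on U (fun x => \det (A x) : R^o).
Proof.
move=> sA; apply: (@smooth_on_sum _ _ _ (fun (s : 'S_m) x =>
  (-1) ^+ s * \prod_(i < m) A x i (s i))) => s.
by apply: smooth_onZ; apply: smooth_on_prod => i; exact: sA.
Qed.

Lemma smooth_on_invmx m (A : V -> 'M[R]_m) i j :
  (forall x, U x -> A x \in unitmx) ->
  (forall i j, smooth_on U (fun x => A x i j : R^o)) ->
  smooth_on U (fun x => invmx (A x) i j : R^o).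
Proof.
move=> uA sA; apply: (@smooth_on_eq (fun x => (\det (A x))^-1 *
    ((-1) ^+ (j + i) * \det (row' j (col' i (A x)))))) => [x Ux|].
  by rewrite /invmx uA// !mxE.
have sC : smooth_on U (fun x => (-1) ^+ (j + i) * \det (row' j (col' i (A x))) : R^o).
  apply/smooth_onZ/smooth_on_det => k l.
  by apply: smooth_on_eq (sA (lift j k) (lift i l)) => x _; rewrite !mxE.
apply: smooth_onM sC; apply: smooth_onV (smooth_on_det sA) => x /uA.
by rewrite unitmxE unitfE.
Qed.

End SmoothFunctions.

Lemma smooth_on_comp {R : realType} (V V' : normedModType R) (U : set V)
    (U' : set V') (i l : V' -> V) (f : V -> R^o) : continuous i ->
  (forall (h : R) v x, i (h *: v + x) = h *: l v + i x) ->
  (forall x, U' x -> U (i x)) -> smooth_on U f -> smooth_on U' (f \o i).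
Proof.
move=> ic il iU /smooth_onP sf; apply/smooth_onP => k.
exact: Ck_comp ic il iU (sf k).
Qed.

(** * Mean value theorem, linearity in the direction, symmetry of second derivatives *)

Section DirectionalDerivatives.
Context {R : realType} {V : normedModType R}.
Implicit Types (f : V -> R^o) (U : set V).

Lemma is_derive_segment f x v (t : R) : derivable f (x + t *: v) v ->
  is_derive t 1 (fun s : R => f (x + s *: v) : R) ('D_v f (x + t *: v)).
Proof.
pose g (s : R) : R^o := f (x + s *: v).
have e (h : R) : (f \o shift (x + t *: v)) (h *: v) = (g \o shift t) (h *: 1).
  by rewrite /g /= addrCA -scalerDl [h *: 1]mulr1.
have E : (fun h => h^-1 *: ((f \o shift (x + t *: v)) (h *: v) - f (x + t *: v)))
    = (fun h => h^-1 *: ((g \o shift t) (h *: 1) - g t)).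
  by apply/funext => h; rewrite e.
rewrite /derivable E => df; split; first exact: df.
by rewrite /derive E.
Qed.

Lemma mean_value f x v :
  (forall t : R, 0 <= t <= 1 -> derivable f (x + t *: v) v) ->
  exists2 t : R, 0 < t < 1 & f (x + v) - f x = 'D_v f (x + t *: v).
Proof.
move=> df.
have id1 (t : R) : 0 <= t <= 1 ->
    is_derive t 1 (fun s : R => f (x + s *: v) : R) ('D_v f (x + t *: v)).
  by move=> t01; exact/is_derive_segment/df.
have [||t t01] := @MVT R (fun s : R => f (x + s *: v) : R)
   (fun t => 'D_v f (x + t *: v)) 0 1 ltr01.
- by move=> t; rewrite in_itv/= => /andP[? ?]; apply: id1; rewrite !ltW.
- apply: derivable_within_continuous => t; rewrite in_itv/= => t01.
  by have [] := id1 t t01.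
rewrite scale1r scale0r addr0 subr0 mulr1 => e.
by exists t => //; move: t01; rewrite in_itv.
Qed.

(** Chain rule in one real variable on the line x + h v; derivability in the single direction [v]
    suffices. *)
Lemma deriveZdir f x v (a : R) : derivable f x v -> 
  'D_(a *: v) f x = a * 'D_v f x.
Proof.
have [->|a0] := eqVneq a 0; first by rewrite scale0r derive0 mul0r.
move=> df.
pose g (h : R) : R := f (x + h *: v).
pose m (h : R) : R := (a *: @id R) h.
have m0 : m 0 = 0 by rewrite /m fctE /GRing.scale/= mulr0.
have dm : is_derive (0 : R) 1 m (a *: 1) by exact: is_deriveZ.
have dg : is_derive (m 0) 1 g ('D_v f x).
  have e : x = x + m 0 *: v by rewrite m0 scale0r addr0.
  by rewrite [in X in is_derive _ _ _ X]e; apply: is_derive_segment; rewrite -e.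
have [dm1 dm2] := dm; have [dg1 dg2] := dg.
have := @derive1_comp R m g 0 dm1 dg1.
rewrite !derive1E dg2 dm2 /GRing.scale/= mulr1 mulrC => <-.
rewrite /derive.
have -> // : (fun h => h^-1 *: ((f \o shift x) (h *: (a *: v)) - f x))
    = (fun h => h^-1 *: (((g \o m) \o shift 0) (h *: 1) - (g \o m) 0)).
apply/funext => h; rewrite /g /= m0 addr0 scale0r addr0 [h *: 1]mulr1.
have -> : m h = h * a by rewrite /m fctE mulrC.
by rewrite scalerA [x + _]addrC.
Qed.

Lemma near_points (U : set V) x : open U -> U x -> forall f, {for x, continuous f} ->
  forall e : R, 0 < e -> exists2 r : R, 0 < r &
    forall y, `|y - x| < r -> U y /\ `|f y - f x| < e.
Proof.
move=> oU Ux f fc e e0.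
have : \forall y \near x, U y /\ `|f y - f x| < e.
  apply: filterI; first exact: open_nbhs_nbhs.
  by move/cvgrPdist_lt : fc => /(_ _ e0); apply: filterS => y; rewrite distrC.
move=> /nbhs_ballP [r /= r0 rP]; exists r => // y yx.
by apply: rP; rewrite -ball_normE /= distrC.
Qed.

(** Meant for mean value arguments, where the two equal values are attained at different points near
    [x]. *)
Lemma eq_of_near (f g : V -> R^o) x : {for x, continuous f} -> {for x, continuous g} ->
  (forall r : R, 0 < r -> exists y z, [/\ `|y - x| < r, `|z - x| < r & f y = g z]) ->
  f x = g x.
Proof.
move=> fc gc H; apply/eqP/negPn/negP => fg.
pose e := `|f x - g x| / 2.
have e0 : 0 < e by rewrite divr_gt0// normr_gt0 subr_eq0.
have [r r0 rP] := near_points openT (I : [set: V] x) fc e0.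
have [s s0 sP] := near_points openT (I : [set: V] x) gc e0.
have [|y [z [yx zx fgyz]]] := H (Num.min r s); first by rewrite lt_min r0.
move: yx zx; rewrite !lt_min => /andP[/rP[_ h1] _] /andP[_ /sP[_ h2]].
suff : `|f x - g x| < e + e by rewrite /e -splitr ltxx.
have -> : f x - g x = (g z - g x) - (f y - f x) by rewrite fgyz; ring.
by apply: le_lt_trans (ler_normB _ _) _; exact: ltrD.
Qed.

Lemma small_parallelogram (u v : V) (r : R) : 0 < r ->
  exists2 t : R, 0 < t & forall x (a b : R), 0 <= a <= 1 -> 0 <= b <= 1 ->
    `|x + a *: (t *: u) + b *: (t *: v) - x| < r.
Proof.
(* The summand 1 keeps the denominator of [t] positive even if both vectors vanish. *)
move=> r0; have u1 : 0 < `|u| + `|v| + 1 by rewrite ltr_wpDl// addr_ge0.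
have t0 : 0 < r / (`|u| + `|v| + 1) by exact: divr_gt0.
have tr : r / (`|u| + `|v| + 1) * (`|u| + `|v|) < r.
  by rewrite mulrAC ltr_pdivrMr// ltr_pM2l// ltrDl.
exists (r / (`|u| + `|v| + 1)) => // x a b /andP[a0 a1] /andP[b0 b1].
move: (r / _) t0 tr => t t0 tr.
rewrite -[x + _ + _]addrA [_ - x]addrC addKr.
apply: le_lt_trans (ler_normD _ _) _.
rewrite !normrZ (ger0_norm a0) (ger0_norm b0) (gtr0_norm t0).
apply: le_lt_trans tr.
by rewrite mulrDr; apply: lerD; apply: ler_piMl => //; exact: mulr_ge0 (ltW t0) _.
Qed.

Section OpenDomain.
Variable U : set V.
Hypothesis oU : open U.

Lemma nbhs_radius x : U x -> exists2 r : R, 0 < r & forall y, `|y - x| < r -> U y.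
Proof.
move=> Ux; have [|r r0 rP] := near_points oU Ux (f := cst 0) _ ltr01.
  exact: cvg_cst.
by exists r => // y /rP[].
Qed.

(** Additivity comes from the continuity of the directional derivatives. The increment of f along
    t(u+v) is the one along tu followed by the one along tv; the mean value theorem is applied to
    all three, with t small. *)
Lemma deriveDdir f x u v : smooth_on U f -> U x ->
  'D_(u + v) f x = 'D_u f x + 'D_v f x.
Proof.
move=> sf Ux; apply/eqP/negPn/negP; rewrite -subr_eq0 => fx.
set d : R := _ - _ in fx.
have e0 : 0 < `|d| / 3 by rewrite divr_gt0// normr_gt0.
have near_D w : exists2 r : R, 0 < r & forall y, `|y - x| < r ->
    U y /\ `|'D_w f y - 'D_w f x| < `|d| / 3.
  apply: near_points => //.
  exact: smooth_on_continuous (smooth_on_deriv w sf) Ux.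
have [r1 r10 P1] := near_D (u + v).
have [r2 r20 P2] := near_D u.
have [r3 r30 P3] := near_D v.
(* With this [t] each of the three derivatives stays within |d|/3 of its value at [x], which leads
   to |d| < |d|. *)
have [|t t0 tP] := @small_parallelogram u v (Num.min r1 (Num.min r2 r3)).
  by rewrite !lt_min r10 r20.
have df y w (s : R) : U y -> derivable f y (s *: w).
  by move=> Uy; exact: smooth_on_derivable sf Uy.
have close (a b : R) : 0 <= a <= 1 -> 0 <= b <= 1 ->
    [/\ `|x + a *: (t *: u) + b *: (t *: v) - x| < r1,
        `|x + a *: (t *: u) + b *: (t *: v) - x| < r2 &
        `|x + a *: (t *: u) + b *: (t *: v) - x| < r3].
  by move=> a01 b01; have := tP x a b a01 b01; rewrite !lt_min => /and3P[].
have t01 (a : R) : 0 < a < 1 -> 0 <= a <= 1 by move=> /andP[? ?]; rewrite !ltW.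
have I0 : 0 <= (0 : R) <= (1 : R) by rewrite lexx ler01.
have I1 : 0 <= (1 : R) <= (1 : R) by rewrite lexx ler01.
have [|a a01 ea] := @mean_value f x (t *: (u + v)).
  move=> s s01; apply: df; have [/P1[+ _] _ _] := close _ _ s01 s01.
  by rewrite -addrA -scalerDr -scalerDr.
have [|b b01 eb] := @mean_value f x (t *: u).
  move=> s s01; apply: df; have [/P1[+ _] _ _] := close _ _ s01 I0.
  by rewrite scale0r addr0.
have [|c c01 ec] := @mean_value f (x + t *: u) (t *: v).
  move=> s s01; apply: df; have [/P1[+ _] _ _] := close _ _ I1 s01.
  by rewrite scale1r.
have [/P1[Ua +] _ _] := close _ _ (t01 _ a01) (t01 _ a01).
rewrite -addrA -!scalerDr in Ua * => ha.
have [_ /P2[Ub +] _] := close _ _ (t01 _ b01) I0.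
rewrite scale0r addr0 in Ub * => hb.
have [_ _ /P3[Uc +]] := close _ _ I1 (t01 _ c01).
rewrite scale1r in Uc * => hc.
rewrite deriveZdir in ea; last exact: smooth_on_derivable sf Ua.
rewrite deriveZdir in eb; last exact: smooth_on_derivable sf Ub.
rewrite deriveZdir in ec; last exact: smooth_on_derivable sf Uc.
have e : 'D_(u + v) f (x + a *: (t *: (u + v))) =
    'D_u f (x + b *: (t *: u)) + 'D_v f (x + t *: u + c *: (t *: v)).
  apply: (mulfI (lt0r_neq0 t0)); rewrite mulrDr -ea -eb -ec scalerDr [x + (_ + _)]addrA.
  by rewrite [RHS]addrC subrKA.
suff : `|d| < `|d| by rewrite ltxx.
have {2}-> : `|d| = `|d| / 3 + `|d| / 3 + `|d| / 3 by field.
have dE : d = ('D_u f (x + b *: (t *: u)) - 'D_u f x)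
  + ('D_v f (x + t *: u + c *: (t *: v)) - 'D_v f x)
  - ('D_(u + v) f (x + a *: (t *: (u + v))) - 'D_(u + v) f x).
  have gen (p q s p0 q0 s0 : R) : s = p + q -> s0 - (p0 + q0) = p - p0 + (q - q0) - (s - s0).
    by move=> ->; ring.
  exact: gen e.
rewrite {1}dE; apply: le_lt_trans (ler_normB _ _) _; apply: ltrD ha.
by apply: le_lt_trans (ler_normD _ _) _; exact: ltrD hb hc.
Qed.

(** Mean value theorem twice: along [u] for y -> f(y + v) - f(y), then along [v] for ['D_u f]. *)
Lemma second_difference f x (u v : V) : smooth_on U f ->
  (forall a b : R, 0 <= a <= 1 -> 0 <= b <= 1 -> U (x + a *: u + b *: v)) ->
  exists a b : R, [/\ 0 <= a <= 1, 0 <= b <= 1 &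
    f (x + u + v) - f (x + u) - (f (x + v) - f x)
      = 'D_v ('D_u f) (x + a *: u + b *: v)].
Proof.
move=> sf Uxab.
have I0 : 0 <= (0 : R) <= (1 : R) by rewrite lexx ler01.
have I1 : 0 <= (1 : R) <= (1 : R) by rewrite lexx ler01.
have df (a b : R) w : 0 <= a <= 1 -> 0 <= b <= 1 -> derivable f (x + a *: u + b *: v) w.
  by move=> a01 b01; exact: smooth_on_derivable sf (Uxab _ _ a01 b01).
pose g y : R^o := f (y + v) - f y.
have gD (a : R) : 0 <= a <= 1 -> is_derive (x + a *: u) u g
    ('D_u f (x + a *: u + v) - 'D_u f (x + a *: u)).
  move=> a01; have d1 : derivable f (x + a *: u) u.
    by have := df a 0 u a01 I0; rewrite scale0r addr0.
  have E : (fun h => h^-1 *: (((f \o shift v) \o shift (x + a *: u)) (h *: u)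
        - (f \o shift v) (x + a *: u)))
      = (fun h => h^-1 *: ((f \o shift (x + a *: u + v)) (h *: u) - f (x + a *: u + v))).
    by apply/funext => h; rewrite /= -[h *: u + _ + v]addrA.
  have d2 : derivable (f \o shift v) (x + a *: u) u.
    rewrite /derivable E.
    by have := df a 1 u a01 I1; rewrite scale1r; exact: id.
  have e2 : 'D_u (f \o shift v) (x + a *: u) = 'D_u f (x + a *: u + v).
    by rewrite /derive E.
  by split; [exact: derivableB d2 d1|rewrite -e2; exact: deriveB d2 d1].
have [|a a01 ea] := @mean_value g x u.
  by move=> s s01; have [] := gD s s01.
have a01' : 0 <= a <= 1 by case/andP: a01 => ? ?; rewrite !ltW.
have [|b b01 eb] := @mean_value ('D_u f) (x + a *: u) v.
  by move=> s s01; exact: smooth_on_derivable (smooth_on_deriv u sf) (Uxab _ _ a01' s01).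
exists a, b; split => //; first by case/andP: b01 => ? ?; rewrite !ltW.
by rewrite -eb -(@derive_val _ _ _ _ _ _ _ (gD a a01')) -ea.
Qed.

(* The same second difference equals either mixed derivative at some point
   arbitrarily close to x. *)
Lemma schwarz f x u v : smooth_on U f -> U x ->
  'D_u ('D_v f) x = 'D_v ('D_u f) x.
Proof.
move=> sf Ux; have [r0 r00 r0P] := nbhs_radius Ux.
have sD w w' : smooth_on U ('D_w ('D_w' f)) by do 2 apply: smooth_on_deriv.
apply: (@eq_of_near ('D_u ('D_v f)) ('D_v ('D_u f))) => [||r r1]; [exact: smooth_on_continuous (sD _ _) Ux..|].
have [|t t0 tP] := @small_parallelogram u v (Num.min r r0); first by rewrite lt_min r1.
have tU (a b : R) : 0 <= a <= 1 -> 0 <= b <= 1 ->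
    U (x + a *: (t *: u) + b *: (t *: v)).
  by move=> a01 b01; have := tP x a b a01 b01; rewrite lt_min => /andP[_ /r0P].
have tU' (a b : R) : 0 <= a <= 1 -> 0 <= b <= 1 ->
    U (x + a *: (t *: v) + b *: (t *: u)).
  by move=> a01 b01; rewrite addrAC; exact: tU.
have [a [b [a01 b01 e1]]] := second_difference sf tU.
have [c [d [c01 d01 e2]]] := second_difference sf tU'.
have DD w w' y : U y -> 'D_(t *: w) ('D_(t *: w') f) y = t * t * 'D_w ('D_w' f) y.
  move=> Uy; have dw : derivable ('D_w' f) y w.
    exact: smooth_on_derivable (smooth_on_deriv _ sf) Uy.
  rewrite deriveZdir; last exact: smooth_on_derivable (smooth_on_deriv _ sf) Uy.
  rewrite -mulrA; congr (_ * _); apply: etrans (deriveZ t dw).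
  apply: near_eq_derive; apply: filterS (open_nbhs_nbhs (conj oU Uy)) => z Uz.
  have dz : derivable f z w' by exact: smooth_on_derivable sf Uz.
  exact: etrans (deriveZdir t dz) _.
have Uab := tU _ _ a01 b01; have Ucd := tU' _ _ c01 d01.
exists (x + c *: (t *: v) + d *: (t *: u)), (x + a *: (t *: u) + b *: (t *: v)).
split.
- by have := tP x d c d01 c01; rewrite [x + _ + _]addrAC lt_min => /andP[].
- by have := tP x a b a01 b01; rewrite lt_min => /andP[].
have gen (p q p1 q1 : R) : p - q - (p1 - q1) = p - p1 - (q - q1) by ring.
apply: (mulfI (lt0r_neq0 (mulr_gt0 t0 t0))).
apply: etrans (etrans (esym (DD u v _ Ucd)) _) (DD v u _ Uab).
by rewrite -e1 -e2 [x + t *: v + t *: u]addrAC; exact: gen.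
Qed.

End OpenDomain.

End DirectionalDerivatives.

(** * Smoothness of the local Finsler formulas *)

Section LinearMaps.
Context {R : realType} {V W : normedModType R}.
Implicit Types f : V -> W.

Lemma smooth_on_const U (w : W) : smooth_on U (fun _ : V => w).
Proof.
move=> vs x _; have [w' ->] : exists w', iter_deriv (fun _ : V => w) vs = fun=> w'.
  elim: vs => [|v vs [w' /= ->]]; first by exists w.
  by exists 0; apply/funext => y; exact: derive_cst.
by split=> [|v]; [exact: cvg_cst|exact: derivable_cst].
Qed.

Lemma is_derive_linear f x v : (forall (h : R) v x, f (h *: v + x) = h *: f v + f x) ->
  is_derive x v f (f v).
Proof.
move=> fl; have E : \forall h \near 0^', h^-1 *: ((f \o shift x) (h *: v) - f x) = f v.
  near=> h; have h0 : h != 0 by near: h; exact: nbhs_dnbhs_neq.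
  by rewrite /= fl addrK scalerA mulVf// scale1r.
split; first exact: is_cvg_near_cst E.
exact: lim_near_cst E.
Unshelve. all: by end_near. Qed.

Lemma smooth_on_linear U f : continuous f ->
  (forall (h : R) v x, f (h *: v + x) = h *: f v + f x) -> smooth_on U f.
Proof.
move=> fc fl vs x _; elim/last_ind: vs => [|vs v _].
  by split=> [|v]; [exact: fc|have [] := is_derive_linear x v fl].
rewrite /iter_deriv foldr_rcons.
have -> : 'D_v f = fun=> f v.
  by apply/funext => y; exact: (@derive_val _ _ _ _ _ _ _ (is_derive_linear y v fl)).
exact: (@smooth_on_const [set: V] (f v) vs x I).
Qed.

End LinearMaps.

Section LinearDirection.
Context {R : realType} {V : normedModType R}.

Lemma derive_sumdir (U : set V) (f : V -> R^o) x I (r : seq I) (a : I -> R) (u : I -> V) :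
  open U -> smooth_on U f -> U x ->
  'D_(\sum_(i <- r) a i *: u i) f x = \sum_(i <- r) a i * 'D_(u i) f x.
Proof.
move=> oU sf Ux; elim: r => [|i r IH]; first by rewrite !big_nil derive0.
rewrite !big_cons (deriveDdir oU)// IH deriveZdir//.
exact: smooth_on_derivable sf Ux.
Qed.

Lemma open_neq0 : open [set y : V | y != 0].
Proof.
have -> : [set y : V | y != 0] = (fun y : V => `|y|) @^-1` [set r : R | 0 < r].
  by apply/seteqP; split => y /=; rewrite normr_gt0.
by apply: open_comp; [move=> y _; exact: norm_continuous|exact: open_gt].
Qed.

End LinearDirection.

Section RowVectors.
Context {R : realType} {n : nat}.
Notation vec := 'rV[R]_n.

Lemma derive_basis (U : set vec) (f : vec -> R^o) x h :
  open U -> smooth_on U f -> U x ->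
  'D_h f x = \sum_(k < n) h 0 k * 'D_(basis_vec k) f x.
Proof.
move=> oU sf Ux; rewrite [in LHS](row_sum_delta h).
exact: (@derive_sumdir _ _ _ _ _ _ _ (fun k => h 0 k) (@basis_vec R n) oU sf Ux).
Qed.

Lemma coord_le (h : vec) k : `|h 0 k| <= `|h|.
Proof.
rewrite [leRHS]/Num.Def.normr/= mx_normrE.
exact: (@le_bigmax _ _ _ 0 (fun i : 'I_1 * 'I_n => `|h i.1 i.2|) (0, k)).
Qed.

Variable C : set vec.
Hypothesis oC : open C.

(** The part of TM_0 over the chart image [C], written as in [fs_smooth] so that the smoothness of F
    applies directly. *)
Definition slit_domain : set (vec * vec) := [set z | C z.1 /\ z.2 != 0].

Lemma slit_domain_open : open slit_domain.
Proof.
have -> : slit_domain = (fst @^-1` C) `&` (snd @^-1` [set y | y != 0]) by [].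
apply: openI; apply: open_comp => //; try exact: open_neq0.
  by move=> z _; exact: cvg_fst.
by move=> z _; exact: cvg_snd.
Qed.

Definition smooth2 (f : vec -> vec -> R) : Prop :=
  smooth_on slit_domain (fun z => f z.1 z.2 : R^o).

Implicit Types f : vec -> vec -> R.

(** Partial derivatives of a curried function are directional derivatives on the product, so
    [smooth2] is stable under them. *)
Lemma dx_uncurry k f :
  (fun z => dx k f z.1 z.2) = 'D_(basis_vec k, 0) (fun z : vec * vec => f z.1 z.2 : R^o).
Proof.
apply/funext => -[x y]; rewrite /dx /derive /=.
by under [in RHS]eq_fun do rewrite scaler0 add0r.
Qed.

Lemma dy_uncurry k f :
  (fun z => dy k f z.1 z.2) = 'D_(0, basis_vec k) (fun z : vec * vec => f z.1 z.2 : R^o).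
Proof.
apply/funext => -[x y]; rewrite /dy /derive /=.
by under [in RHS]eq_fun do rewrite scaler0 add0r.
Qed.

Lemma smooth2_dx k f : smooth2 f -> smooth2 (dx k f).
Proof. by rewrite /smooth2 dx_uncurry; exact: smooth_on_deriv. Qed.

Lemma smooth2_dy k f : smooth2 f -> smooth2 (dy k f).
Proof. by rewrite /smooth2 dy_uncurry; exact: smooth_on_deriv. Qed.

Lemma smooth2D f1 f2 :
  smooth2 f1 -> smooth2 f2 -> smooth2 (fun x y => f1 x y + f2 x y).
Proof. exact: smooth_onD slit_domain_open _ _. Qed.

Lemma smooth2B f1 f2 :
  smooth2 f1 -> smooth2 f2 -> smooth2 (fun x y => f1 x y - f2 x y).
Proof. exact: smooth_onB slit_domain_open _ _. Qed.

Lemma smooth2N f : smooth2 f -> smooth2 (fun x y => - f x y).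
Proof. exact: smooth_onN slit_domain_open _. Qed.

Lemma smooth2M f1 f2 :
  smooth2 f1 -> smooth2 f2 -> smooth2 (fun x y => f1 x y * f2 x y).
Proof. exact: smooth_onM slit_domain_open _ _. Qed.

Lemma smooth2Z c f : smooth2 f -> smooth2 (fun x y => c * f x y).
Proof. exact: smooth_onZ slit_domain_open _ _. Qed.

Lemma smooth2_sum (I : finType) (f : I -> vec -> vec -> R) :
  (forall i, smooth2 (f i)) -> smooth2 (fun x y => \sum_i f i x y).
Proof. by move=> sf; exact: (smooth_on_sum slit_domain_open). Qed.

Lemma smooth2_base (p : vec -> R) : smooth_on C (p : _ -> R^o) -> smooth2 (fun x _ => p x).
Proof.
move=> sp; apply: (smooth_on_comp (U := C) (i := fst) (l := fst)) sp => //.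
- by move=> z; exact: cvg_fst.
- by move=> z [].
Qed.

Lemma smooth2_coord k : smooth2 (fun _ y => y 0 k).
Proof.
apply: (smooth_on_comp (U := [set: vec]) (i := snd) (l := snd) (f := fun y : vec => y 0 k : R^o)) => //.
  by move=> z; exact: cvg_snd.
apply: smooth_on_linear => [y|h v x]; first exact: coord_continuous.
by rewrite !mxE.
Qed.

Lemma smooth2_left f y : y != 0 -> smooth2 f -> smooth_on C (fun x => f x y : R^o).
Proof.
move=> y0 sf.
apply: (smooth_on_comp (U := slit_domain) (i := fun x => (x, y)) (l := fun v => (v, 0))
  (f := fun z => f z.1 z.2)) sf => //.
- by move=> x; apply: differentiable_continuous; exact: differentiable_pair.
- by move=> h v x; rewrite /= -[RHS]/(h *: v + x, h *: 0 + y) scaler0 add0r.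
Qed.

Lemma smooth2_right f x : C x -> smooth2 f -> smooth_on [set y | y != 0] (f x : _ -> R^o).
Proof.
move=> Cx sf.
apply: (smooth_on_comp (U := slit_domain) (i := fun y => (x, y)) (l := fun v => (0, v))
  (f := fun z => f z.1 z.2)) sf => //.
- by move=> y; apply: differentiable_continuous; exact: differentiable_pair.
- by move=> h v y; rewrite /= -[RHS]/(h *: 0 + x, h *: v + y) scaler0 add0r.
Qed.

Section Structure.
Variable L : vec -> vec -> R.
Hypothesis sL : smooth2 L.
Hypothesis pL : forall x y u, C x -> y != 0 -> u != 0 -> 0 < inner L x y u u.

Lemma smooth2_sq : smooth2 (sq L).
Proof.
have -> : sq L = fun x y => L x y * L x y by apply/funext => x; apply/funext => y; rewrite /sq expr2.
exact: smooth2M.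
Qed.

Lemma smooth2_g i j : smooth2 (g_ L i j).
Proof. exact: smooth2Z (smooth2_dy i (smooth2_dy j smooth2_sq)). Qed.

(** A nonzero [v] in the left kernel of the matrix would satisfy g(v, v) = 0. *)
Lemma g_unitmx x y : C x -> y != 0 -> \matrix_(k < n, l < n) g_ L k l x y \in unitmx.
Proof.
move=> Cx y0; rewrite -row_free_unit; apply: inj_row_free => v vG.
apply/eqP/negPn/negP => v0; have := pL Cx y0 v0.
suff -> : inner L x y v v = 0 by rewrite ltxx.
rewrite /inner exchange_big/= big1// => j _.
rewrite -mulr_suml; have /rowP/(_ j) := vG; rewrite !mxE => e.
rewrite (_ : \sum_i _ = 0) ?mul0r// -[RHS]e; apply: eq_bigr => i _.
by rewrite mxE mulrC.
Qed.

Lemma smooth2_ginv i j : smooth2 (ginv L i j).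
Proof.
apply: (smooth_on_invmx slit_domain_open (A := fun z => \matrix_(k < n, l < n) g_ L k l z.1 z.2)).
  by move=> z [? ?]; exact: g_unitmx.
move=> k l; apply: (smooth_on_eq slit_domain_open) (smooth2_g k l) => z _.
by rewrite mxE.
Qed.

Lemma smooth2_spray i : smooth2 (spray L i).
Proof.
rewrite /spray; apply: smooth2Z; apply: smooth2_sum => l; apply: smooth2M (smooth2_ginv _ _) _.
apply: smooth2B; last exact/smooth2_dx/smooth2_sq.
apply: smooth2_sum => k; apply: smooth2M (smooth2_coord k).
exact/smooth2_dy/smooth2_dx/smooth2_sq.
Qed.

Lemma smooth2_delta i f : smooth2 f -> smooth2 (delta L i f).
Proof.
rewrite /delta => sf; apply: smooth2B; first exact: smooth2_dx.
apply: smooth2_sum => j; apply: smooth2M; last exact: smooth2_dy.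
exact/smooth2_dy/smooth2_spray.
Qed.

Lemma smooth2_Gam i j k : smooth2 (Gam L i j k).
Proof.
rewrite /Gam; apply: smooth2Z; apply: smooth2_sum => l; apply: smooth2M (smooth2_ginv _ _) _.
by apply: smooth2B; first apply: smooth2D; exact/smooth2_delta/smooth2_g.
Qed.

Lemma smooth2_Ccoef i j k : smooth2 (Ccoef L i j k).
Proof.
rewrite /Ccoef; apply: smooth2Z; apply: smooth2_sum => l; apply: smooth2M (smooth2_ginv _ _) _.
exact/smooth2_dy/smooth2_g.
Qed.

Lemma smooth2_grad (p : vec -> R) i : smooth_on C (p : _ -> R^o) ->
  smooth2 (fun x y => grad L p x y 0 i).
Proof.
move=> sp.
have -> : (fun x y => grad L p x y 0 i) = (fun x y => \sum_(j < n) ginv L i j x y * d1 j p x).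
  by apply/funext => x; apply/funext => y; rewrite mxE.
apply: smooth2_sum => j; apply: smooth2M (smooth2_ginv _ _) _.
by apply: smooth2_base; exact: smooth_on_deriv.
Qed.

(** Lowering the index of the gradient recovers dp, which does not involve [y]. This is the identity
    to be differentiated vertically. *)
Lemma g_grad (p : vec -> R) i x y : C x -> y != 0 ->
  \sum_(j < n) g_ L i j x y * grad L p x y 0 j = d1 i p x.
Proof.
move=> Cx y0; pose G := \matrix_(k < n, l < n) g_ L k l x y.
pose q : 'cV[R]_n := \col_j d1 j p x.
have -> : d1 i p x = (G *m (invmx G *m q)) i 0.
  by rewrite mulKVmx ?mxE//; exact: g_unitmx.
rewrite mxE; apply: eq_bigr => j _; rewrite !mxE; congr (_ * _).
by apply: eq_bigr => k _; rewrite !mxE.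
Qed.

End Structure.
End RowVectors.

(** * Homogeneous functions on a punctured vector space *)

Section Parallel.
Context {R : realType} {n : nat}.
Notation vec := 'rV[R]_n.

Lemma exists_neq_ord (i : 'I_n) : (1 < n)%N -> exists j : 'I_n, j != i.
Proof.
move=> n1; have n0 : (0 < n)%N by exact: ltn_trans n1.
by have [e|e] := eqVneq (i : nat) 0%N; [exists (Ordinal n1)|exists (Ordinal n0)];
  rewrite -val_eqE /= ?e// eq_sym.
Qed.

Definition independent (u v : vec) := forall a b : R, a *: u + b *: v = 0 -> a = 0 /\ b = 0.

Lemma independent_neq0 u v (a b : R) : independent u v -> (a != 0) || (b != 0) ->
  a *: u + b *: v != 0.
Proof.
by move=> uv; apply: contraTneq => /uv[-> ->]; rewrite eqxx.
Qed.

Lemma independent_or u v : v != 0 -> independent u v \/ exists c : R, u = c *: v.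
Proof.
move=> v0; have [[c e]|nc] := pselect (exists c : R, u = c *: v); [by right; exists c|left].
move=> a b e; have a0 : a = 0.
  apply/eqP/negPn/negP => a0; apply: nc; exists (- (b / a)).
  apply: (scalerI a0); rewrite scalerA mulrN mulrCA divff// mulr1 scaleNr.
  by apply/eqP; rewrite -addr_eq0 e.
split => //; move/eqP: e; rewrite a0 scale0r add0r scaler_eq0 (negPf v0) orbF.
by move/eqP.
Qed.

Lemma exists_independent (v : vec) : (1 < n)%N -> v != 0 -> exists e, independent e v.
Proof.
move=> n1 /rV0Pn[i vi].
have [j ji] := exists_neq_ord i n1.
exists (delta_mx 0 j) => a b e.
have b0 : b = 0.
  have /rowP/(_ i) := e; rewrite !mxE eqxx /= eq_sym (negPf ji) mulr0 add0r => /eqP.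
  by rewrite mulf_eq0 (negPf vi) orbF => /eqP.
split=> //; have /rowP/(_ j) := e.
by rewrite b0 !mxE !eqxx mul0r addr0 mulr1.
Qed.

End Parallel.

Section PunctureConstancy.
Context {R : realType} {n : nat}.
Notation vec := 'rV[R]_n.
Notation punctured := [set y : vec | y != 0].
Implicit Types h : vec -> R^o.

Lemma constant_on_segment h u w : smooth_on punctured h ->
  (forall y, y != 0 -> 'D_w h y = 0) ->
  (forall t : R, 0 <= t <= 1 -> u + t *: w != 0) -> h (u + w) = h u.
Proof.
move=> sh Dh uw; apply/eqP; rewrite -subr_eq0; apply/eqP.
have [t t01|t t01 ->] := @mean_value R _ h u w.
  by apply: smooth_on_derivable sh _; exact: uw.
by apply/Dh/uw; case/andP: t01 => *; rewrite !ltW.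
Qed.

(** The segment between two independent vectors avoids 0. Two dependent vectors are compared through
    a third one, independent of both, which exists as n >= 2. *)
Lemma constant_on_punctured h y z : (1 < n)%N -> smooth_on punctured h ->
  (forall v y, y != 0 -> 'D_v h y = 0) -> y != 0 -> z != 0 -> h y = h z.
Proof.
move=> n1 sh Dh.
have ind u v : independent u v -> h u = h v.
  move=> uv; rewrite -[v](subrKC u); apply/esym.
  apply: constant_on_segment => // [x|t _]; first exact: Dh.
  have -> : u + t *: (v - u) = (1 - t) *: u + t *: v.
    by rewrite scalerBr scalerBl scale1r addrA addrAC.
  apply: independent_neq0 => //; have [->|_] := eqVneq t 0; last by rewrite orbT.
  by rewrite subr0 oner_eq0.
move=> y0 z0; have [//|[c yc]] := independent_or y z0; first exact: ind.
have [e ez] := exists_independent n1 z0; rewrite -(ind _ _ ez); apply/esym/ind => a b.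
rewrite yc scalerA => /ez[-> /eqP]; rewrite mulf_eq0 => /orP[/eqP ->//|/eqP c0].
by move: y0; rewrite yc c0 scale0r eqxx.
Qed.

(** Let s tend to 0: the value at an exceptional vector [u] is read off from neighbouring vectors in
    general position. *)
Lemma small_perturbation h u v : {for u, continuous h} ->
  (forall s : R, 0 < s -> h (u + s *: v) = h v) -> h u = h v.
Proof.
move=> hc hs; apply/eqP/negPn/negP => huv.
have e0 : 0 < `|h u - h v| by rewrite normr_gt0 subr_eq0.
have [r r0 rP] := near_points openT (I : [set: vec] u) hc e0.
have [t t0 tP] := @small_parallelogram R _ v 0 _ r0.
have := tP u 1 0; rewrite !scaler0 addr0 scale1r !lexx ler01 => /(_ isT isT)/rP[_].
by rewrite hs// distrC ltxx.
Qed.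

(* Along the direction V the function h is constant, and y + t V becomes
   parallel to V as t goes to infinity. *)
Lemma homogeneous0_constant h V y : (1 < n)%N -> smooth_on punctured h -> V != 0 ->
  (forall y, y != 0 -> 'D_V h y = 0) ->
  (forall (t : R) y, 0 < t -> y != 0 -> h (t *: y) = h y) -> y != 0 -> h y = h V.
Proof.
move=> n1 sh V0 DV hom.
have hc u : u != 0 -> {for u, continuous h} by move=> u0; exact: smooth_on_continuous sh u0.
have ind u : independent u V -> h u = h V.
  move=> uV; apply/esym/small_perturbation; first exact: hc.
  have nz (s t : R) : s != 0 -> s *: u + t *: V != 0.
    by move=> s0; apply: independent_neq0 => //; rewrite s0.
  move=> s s0; have s0' := lt0r_neq0 s0.
  have <- : h (u + s^-1 *: V) = h u.
    apply: constant_on_segment => // [z z0|t _].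
      by rewrite deriveZdir ?DV ?mulr0//; exact: smooth_on_derivable sh z0.
    by rewrite scalerA -[u]scale1r nz ?oner_eq0.
  rewrite -(hom s (u + s^-1 *: V)) //; last by rewrite -[u]scale1r nz ?oner_eq0.
  by rewrite scalerDr scalerA divff// scale1r addrC.
(* A multiple of V, possibly negative, is a limit of vectors y + s e independent of V. *)
move=> y0; have [/ind//|[c yc]] := independent_or y V0.
have c0 : c != 0 by apply: contraNneq y0 => c0; rewrite yc c0 scale0r.
have [e eV] := exists_independent n1 V0; rewrite -(ind _ eV).
apply: small_perturbation => [|s s0]; first exact: hc.
rewrite (ind _ eV); apply: ind => a b.
rewrite yc scalerDr !scalerA addrAC -scalerDl addrC => /eV[/eqP].
rewrite mulf_eq0 (negPf (lt0r_neq0 s0)) orbF => /eqP ->.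
by rewrite mul0r add0r.
Qed.

End PunctureConstancy.

Section Homogeneous.
Context {R : realType} {n : nat}.
Notation vec := 'rV[R]_n.
Notation punctured := [set y : vec | y != 0].
Implicit Types h : vec -> R^o.

Definition homogeneous (m : nat) h :=
  forall (t : R) y, 0 < t -> y != 0 -> h (t *: y) = t ^+ m * h y.

(** Differentiating h(t y) = t^(m+1) h(y) along v gives t D_v h(t y) = t^(m+1) D_v h(y); divide by
    t. *)
Lemma homogeneous_derive m h v : smooth_on punctured h ->
  homogeneous m.+1 h -> homogeneous m ('D_v h).
Proof.
move=> sh hom t y t0 y0.
have ty0 : t *: y != 0 by rewrite scaler_eq0 negb_or lt0r_neq0.
have dy w : derivable h y w by exact: smooth_on_derivable sh y0.
have dty w : derivable h (t *: y) w by exact: smooth_on_derivable sh ty0.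
suff: t * 'D_v h (t *: y) = t ^+ m.+1 * 'D_v h y.
  by rewrite exprS -mulrA => /(mulfI (lt0r_neq0 t0)).
rewrite -(deriveZdir t (dty v)).
have E : (fun s => s^-1 *: ((h \o shift (t *: y)) (s *: (t *: v)) - h (t *: y))) =
    (fun s => s^-1 *: (((fun z => h (t *: z)) \o shift y) (s *: v) - h (t *: y))).
  by apply/funext => s; rewrite /= [t *: (_ + _)]scalerDr [s *: (t *: v)]scalerA [t *: (s *: v)]scalerA [t * s]mulrC.
have -> : 'D_(t *: v) h (t *: y) = 'D_v (fun z => h (t *: z)) y by rewrite /derive E.
apply: etrans (deriveZ (t ^+ m.+1) (dy v)).
apply: near_eq_derive; apply: filterS (open_nbhs_nbhs (conj open_neq0 y0)) => z z0.
exact: hom.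
Qed.

(** Differentiate h((1 + s) y) = (1 + s)^(m+1) h(y) at s = 0; homogeneity is for positive factors,
    hence the restriction to |s| < 1. *)
Lemma euler m h y : smooth_on punctured h -> homogeneous m.+1 h -> y != 0 ->
  'D_y h y = m.+1%:R * h y.
Proof.
move=> sh hom y0.
have d1 : is_derive (0 : R) 1 (fun s : R => h (y + s *: y) : R) ('D_y h y).
  have := @is_derive_segment R _ h y y 0; rewrite scale0r addr0; apply.
  exact: smooth_on_derivable sh y0.
pose p (s : R) : R := h y *: ((cst 1 + @id R) ^+ m.+1) s.
have d2 : is_derive (0 : R) 1 p (h y *: ((m.+1%:R * (1 + 0) ^+ m) *: (0 + 1))).
  exact: is_deriveZ.
have <- : 'D_1 (fun s : R => h (y + s *: y) : R) 0 = 'D_y h y by exact: derive_val.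
have -> : m.+1%:R * h y = 'D_1 p 0.
  by rewrite derive_val add0r addr0 expr1n mulr1 mulrC /GRing.scale/= mulr1.
apply: near_eq_derive; near=> s.
have s1 : 0 < 1 + s.
  have : `|s| < 1.
    near: s; exact: (@nbhs0_lt R R 1 ltr01).
  by rewrite ltr_norml => /andP[]; rewrite -subr_gt0 opprK addrC.
rewrite -[X in X + _]scale1r -scalerDl hom//.
by rewrite /p !fctE /GRing.scale/= mulrC.
Unshelve. all: by end_near. Qed.

End Homogeneous.

(** * The vertical equation *)

Section SchwarzianCoordinates.
Context {R : realType} {n : nat}.
Notation vec := 'rV[R]_n.
Variables (L : vec -> vec -> R) (p : vec -> R).

Definition gradc (i : 'I_n) : vec -> vec -> R := fun x y => grad L p x y 0 i.

Lemma schwarzianE x y h v i : schwarzian L p x y h v 0 i =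
  \sum_(k < n) h 0 k * (delta L k (gradc i) x y
    + \sum_(j < n) Gam L i j k x y * gradc j x y)
  + \sum_(k < n) v 0 k * (dy k (gradc i) x y
    + \sum_(j < n) Ccoef L i j k x y * gradc j x y)
  - inner L x y (grad L p x y) h * gradc i x y
  - n%:R^-1 * (laplacian L p x y - grad_sqnorm L p x y) * h 0 i.
Proof. by rewrite [in LHS]/schwarzian !mxE -[in RHS]/(gradc i x y) /gradc mxE. Qed.

Lemma sum_basis k (T : 'I_n -> R) : \sum_(a < n) basis_vec k 0 a * T a = T k.
Proof.
rewrite (bigD1 k)//= big1 => [|a ak].
  by rewrite mxE !eqxx mul1r addr0.
by rewrite mxE eqxx (negPf ak) mul0r.
Qed.

(** For a vertical vector the image under rho is 0, so only the covariant derivative of the gradient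
    survives. *)
Lemma schwarzian_vertical x y k i : schwarzian L p x y 0 (basis_vec k) = 0 ->
  dy k (gradc i) x y = - \sum_(j < n) Ccoef L i j k x y * gradc j x y.
Proof.
move=> /rowP/(_ i); rewrite schwarzianE !mxE. rewrite mulr0 subr0.
rewrite /inner [in X in _ - X](_ : \sum_i _ = 0) ?mul0r ?subr0; last first.
  by rewrite big1// => a _; rewrite big1// => b _; rewrite [X in _ * X]mxE mulr0.
rewrite [X in X + _]big1 ?add0r; last by move=> a _; rewrite mxE mul0r.
rewrite sum_basis => /eqP.
by rewrite addr_eq0 => /eqP.
Qed.

Lemma schwarzian_horizontal x y h i : schwarzian L p x y h 0 = 0 ->
  \sum_(k < n) h 0 k * (delta L k (gradc i) x y
    + \sum_(j < n) Gam L i j k x y * gradc j x y) =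
  inner L x y (grad L p x y) h * gradc i x y
  + n%:R^-1 * (laplacian L p x y - grad_sqnorm L p x y) * h 0 i.
Proof.
move=> /rowP/(_ i); rewrite schwarzianE !mxE.
rewrite [X in _ + X - _ - _]big1 ?addr0; last by move=> a _; rewrite mxE mul0r.
by rewrite -addrA -opprD => /eqP; rewrite subr_eq0 => /eqP.
Qed.

End SchwarzianCoordinates.

Section Vertical.
Context {R : realType} {n : nat}.
Notation vec := 'rV[R]_n.
Notation punctured := [set y : vec | y != 0].

Lemma derive_sumM (f g : 'I_n -> vec -> R^o) y v :
  (forall j, derivable (f j) y v) -> (forall j, derivable (g j) y v) ->
  'D_v (fun z => \sum_(j < n) f j z * g j z : R^o) y
    = \sum_(j < n) (f j y * 'D_v (g j) y + g j y * 'D_v (f j) y).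
Proof.
move=> df dg.
have -> : (fun z => \sum_(j < n) f j z * g j z : R^o) = \sum_(j < n) (f j * g j).
  by apply/funext => z; rewrite fct_sumE.
rewrite derive_sum => [|j]; last exact: derivableM.
by apply: eq_bigr => j _; rewrite deriveM.
Qed.

Variable C : set vec.
Hypothesis oC : open C.
Variable L : vec -> vec -> R.
Hypothesis sL : smooth2 C L.
Hypothesis pL : forall x y u, C x -> y != 0 -> u != 0 -> 0 < inner L x y u u.
Hypothesis hL : forall x y (t : R), C x -> 0 < t -> L x (t *: y) = t * L x y.
Variable x : vec.
Hypothesis Cx : C x.

Let sq_smooth : smooth_on punctured (sq L x : vec -> R^o).
Proof. exact: smooth2_right Cx (smooth2_sq oC sL). Qed.

Let g_smooth i j : smooth_on punctured (g_ L i j x : vec -> R^o).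
Proof. exact: smooth2_right Cx (smooth2_g oC sL i j). Qed.

Let D3 k i j := 'D_(basis_vec k) ('D_(basis_vec i) ('D_(basis_vec j) (sq L x : vec -> R^o))).

Let g_E i j y : g_ L i j x y = 2^-1 * 'D_(basis_vec i) ('D_(basis_vec j) (sq L x : vec -> R^o)) y.
Proof. by []. Qed.

Lemma g_sym i j y : y != 0 -> g_ L i j x y = g_ L j i x y.
Proof.
move=> y0; rewrite !g_E; apply: (congr1 ( *%R 2^-1)).
exact: (schwarz open_neq0 (basis_vec i) (basis_vec j) sq_smooth y0).
Qed.

Lemma dy_gE k i j y : y != 0 -> dy k (g_ L i j) x y = 2^-1 * D3 k i j y.
Proof.
move=> y0; pose h : vec -> R^o := 'D_(basis_vec i) ('D_(basis_vec j) (sq L x : _ -> R^o)).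
have sh : smooth_on punctured h by do 2 apply: smooth_on_deriv; exact: sq_smooth.
have dh : derivable h y (basis_vec k) := smooth_on_derivable sh y0.
exact: (deriveZ 2^-1 dh).
Qed.

(** Both sides are half a third derivative of F^2, which is symmetric in its three indices. *)
Lemma dy_g_rot k i j y : y != 0 -> dy k (g_ L i j) x y = dy j (g_ L k i) x y.
Proof.
move=> y0; rewrite (dy_gE k i j y0) (dy_gE j k i y0); apply: (congr1 ( *%R 2^-1)).
have sD := smooth_on_deriv (basis_vec i) sq_smooth.
apply: etrans (schwarz open_neq0 (basis_vec k) (basis_vec j) sD y0).
apply: near_eq_derive; apply: filterS (open_nbhs_nbhs (conj open_neq0 y0)) => z z0.
exact: (schwarz open_neq0 (basis_vec i) (basis_vec j) sq_smooth z0).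
Qed.

Lemma sq_homogeneous : homogeneous 2 (sq L x : vec -> R^o).
Proof. by move=> t y t0 _; rewrite /sq hL// exprMn. Qed.

Lemma g_homogeneous0 i j (t : R) y : 0 < t -> y != 0 -> g_ L i j x (t *: y) = g_ L i j x y.
Proof.
move=> t0 y0; rewrite !g_E; apply: (congr1 ( *%R 2^-1)).
have h1 := homogeneous_derive (basis_vec j) sq_smooth sq_homogeneous.
have := homogeneous_derive (basis_vec i) (smooth_on_deriv (basis_vec j) sq_smooth) h1.
by move=> /(_ t y t0 y0); rewrite expr0 mul1r.
Qed.

(** Euler's relation twice: for F^2, of degree 2, and for its first derivatives, of degree 1. *)
Lemma euler_g y : y != 0 -> sq L x y = \sum_(i < n) \sum_(j < n) g_ L i j x y * y 0 i * y 0 j.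
Proof.
move=> y0; pose f : vec -> R^o := sq L x.
have sD j : smooth_on punctured ('D_(basis_vec j) f) by exact: smooth_on_deriv sq_smooth.
have e1 : 'D_y f y = 2 * f y by exact: euler sq_smooth sq_homogeneous y0.
have e2 j : 'D_y ('D_(basis_vec j) f) y = 'D_(basis_vec j) f y.
  rewrite (@euler _ _ 0 _ y (sD j) _ y0) ?mul1r//.
  by apply: homogeneous_derive sq_homogeneous; exact: sq_smooth.
rewrite (derive_basis _ open_neq0 sq_smooth y0) in e1.
have {}e1 : f y = 2^-1 * \sum_(j < n) y 0 j * 'D_(basis_vec j) f y.
  by rewrite e1 mulKf.
rewrite -/(f y) e1 mulr_sumr exchange_big/=; apply: eq_bigr => j _.
rewrite -e2 (derive_basis _ open_neq0 (sD j) y0) mulrA mulr_sumr.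
apply: eq_bigr => i _; rewrite /g_ -/(f) -[dy i _ x y]/('D_(basis_vec i) ('D_(basis_vec j) f) y).
by ring.
Qed.

Lemma g_inj (c : 'I_n -> R) y : y != 0 ->
  (forall m, \sum_(j < n) g_ L m j x y * c j = 0) -> forall j, c j = 0.
Proof.
move=> y0 gc j; pose G := \matrix_(k < n, l < n) g_ L k l x y.
have uG : G \in unitmx by exact: g_unitmx Cx y0.
have Gc : G *m (\col_j c j) = 0.
  apply/colP => m; rewrite !mxE -[RHS](gc m).
  by apply: eq_bigr => k _; rewrite !mxE.
have : \col_j c j = 0 by rewrite -[LHS](mulKmx uG) Gc mulmx0.
by move=> /colP/(_ j); rewrite !mxE.
Qed.

(** Lowering the upper index of C gives the totally symmetric Cartan tensor, half the vertical
    derivative of g. *)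
Lemma g_Ccoef m j k y : y != 0 ->
  \sum_(i < n) g_ L m i x y * Ccoef L i j k x y = 2^-1 * dy m (g_ L j k) x y.
Proof.
move=> y0; pose G := \matrix_(k < n, l < n) g_ L k l x y.
pose q : 'cV[R]_n := \col_l (2^-1 * dy l (g_ L j k) x y).
have -> : 2^-1 * dy m (g_ L j k) x y = (G *m (invmx G *m q)) m 0.
  by rewrite mulKVmx ?mxE//; exact: g_unitmx Cx y0.
rewrite mxE; apply: eq_bigr => i _; rewrite !mxE; congr (_ * _).
rewrite /Ccoef mulr_sumr; apply: eq_bigr => l _; rewrite !mxE /ginv; ring.
Qed.

Variable p : vec -> R.
Hypothesis sp : smooth_on C (p : vec -> R^o).
Hypothesis vp : forall y k, y != 0 -> schwarzian L p x y 0 (basis_vec k) = 0.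

Let gradc_smooth i : smooth_on punctured (gradc L p i x : vec -> R^o).
Proof. exact: smooth2_right Cx (smooth2_grad oC sL pL i sp). Qed.

(* The vertical equation says that the y-derivative of grad is -C(grad), while
   differentiating g(grad) = d p gives -2C(grad): both vanish. *)
Lemma gradc_vertical k y : y != 0 ->
  (forall i, dy k (gradc L p i) x y = 0) /\
  (forall m, \sum_(j < n) dy k (g_ L m j) x y * gradc L p j x y = 0).
Proof.
move=> y0.
have A m : \sum_(j < n) g_ L m j x y * dy k (gradc L p j) x y
    + \sum_(j < n) dy k (g_ L m j) x y * gradc L p j x y = 0.
  rewrite -big_split/=.
  have := @derive_sumM (fun j => g_ L m j x) (fun j => gradc L p j x) y (basis_vec k)
   (fun j => smooth_on_derivable (g_smooth m j) y0)
   (fun j => smooth_on_derivable (gradc_smooth j) y0).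
  rewrite (@near_eq_derive _ _ _ _ (fun=> d1 m p x : R^o)); last first.
    apply: filterS (open_nbhs_nbhs (conj open_neq0 y0)) => z z0.
    have z0' : z != 0 := z0.
    have := g_grad pL p m Cx z0'; exact.
  rewrite derive_cst => e; rewrite [RHS]e; apply: eq_bigr => j _.
  by congr (_ + _); rewrite mulrC.
have B m : \sum_(j < n) g_ L m j x y * dy k (gradc L p j) x y
    = - (2^-1 * \sum_(j < n) dy k (g_ L m j) x y * gradc L p j x y).
  under eq_bigr do rewrite (schwarzian_vertical _ (vp k y0)) mulrN mulr_sumr.
  rewrite sumrN exchange_big/= mulr_sumr; congr (- _); apply: eq_bigr => j _.
  under eq_bigr do rewrite mulrA.
  by rewrite -mulr_suml g_Ccoef// (dy_g_rot m)// mulrA.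
have S m : \sum_(j < n) dy k (g_ L m j) x y * gradc L p j x y = 0.
  by have := A m; rewrite B; lra.
split=> //; apply: (g_inj (c := fun i => dy k (gradc L p i) x y) y0) => m.
by rewrite B S mulr0 oppr0.
Qed.

Hypothesis n1 : (1 < n)%N.
Hypothesis dp : exists i, d1 i p x != 0.

Lemma g_y_independent k l y z : y != 0 -> z != 0 -> g_ L k l x y = g_ L k l x z.
Proof.
move=> y0 z0; pose V : vec := grad L p x z.
(* All vertical derivatives of the gradient vanish, so it has the same value [V] at every nonzero
   y. *)
have VE y' j : y' != 0 -> gradc L p j x y' = V 0 j.
  move=> y'0; apply: (constant_on_punctured n1 (gradc_smooth j)) => // v u u0.
  rewrite (derive_basis _ open_neq0 (gradc_smooth j) u0) big1// => i _.
  by have [/(_ j) e _] := gradc_vertical i u0; rewrite [X in _ * X]e mulr0.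
have V0 : V != 0.
  have [i] := dp; apply: contraNneq => V0.
  rewrite -(g_grad pL p i Cx z0) big1// => j _.
  by rewrite -/V V0 mxE mulr0.
(* By total symmetry V^j dy_j g_kl equals dy_l g_kj V^j, which is zero by the second half of
   [gradc_vertical]. *)
have DV u : u != 0 -> 'D_V (g_ L k l x : vec -> R^o) u = 0.
  move=> u0; rewrite (derive_basis _ open_neq0 (g_smooth k l) u0).
  have [_ /(_ k) e] := gradc_vertical l u0; apply: etrans e; apply: eq_bigr => j _.
  rewrite (VE u j u0) mulrC; apply: (congr1 ( *%R^~ (V 0 j))).
  apply: etrans (dy_g_rot j k l u0) _.
  apply: near_eq_derive; apply: filterS (open_nbhs_nbhs (conj open_neq0 u0)) => w w0.
  exact: g_sym.
have gV u : u != 0 -> g_ L k l x u = g_ L k l x V.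
  apply: (homogeneous0_constant n1 (g_smooth k l) V0 DV) => t w t0 w0.
  exact: g_homogeneous0.
by rewrite !gV.
Qed.

End Vertical.

(** * The horizontal equation and unique continuation *)

Section UniqueContinuation.
Context {R : realType} {n : nat}.
Notation vec := 'rV[R]_n.
Hypothesis n1 : (1 < n)%N.

Lemma basis_norm_le1 (j : 'I_n) : `|basis_vec j : vec| <= 1.
Proof.
rewrite [leLHS]/Num.Def.normr/= mx_normrE bigmax_le// => -[a b] _.
by rewrite mxE; case: (_ && _); rewrite ?normr1 ?normr0.
Qed.

Lemma segment_in_ball (p u v : vec) (r t : R) : 0 <= t <= 1 ->
  `|u - p| < r -> `|v - p| < r -> `|u + t *: (v - u) - p| < r.
Proof.
move=> /andP[t0 t1] up vp.
have -> : u + t *: (v - u) - p = (1 - t) *: (u - p) + t *: (v - p).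
  by apply/rowP => k; rewrite !mxE; ring.
have t1' : 0 <= 1 - t by rewrite subr_ge0.
apply: le_lt_trans (ler_normD _ _) _.
rewrite !normrZ (ger0_norm t0) (ger0_norm t1').
have [->|tn0] := eqVneq t 0; first by rewrite subr0 mul1r mul0r addr0.
have -> : r = (1 - t) * r + t * r by ring.
by apply: ler_ltD; [rewrite ler_wpM2l// ltW|rewrite ltr_pM2l// lt0r tn0].
Qed.

Variables (X : 'I_n -> vec -> R^o) (p : vec) (rho K : R).
Hypothesis K0 : 0 <= K.
Hypothesis dX : forall x h i, `|x - p| < rho -> derivable (X i) x h.
(** Abstract horizontal equation. The multiplier [l] may depend on [x] and [h] but is common to all
    components; the error is linear in a bound for X at [x]. *)
Hypothesis hX : forall x h, `|x - p| < rho -> exists l : R, forall i M,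
  (forall j, `|X j x| <= M) -> `|'D_h (X i) x - l * h 0 i| <= K * `|h| * M.

(* Modulo the direction w, X changes little along the segments of direction w;
   comparing the segments that join q to two points where X vanishes controls
   every component of X at q. *)
Lemma continuation_step (e r M : R) : 0 < e -> e <= r -> r <= 2 * e -> r <= rho ->
  144 * e * K <= 1 ->
  (forall x i, `|x - p| < e -> X i x = 0) ->
  (forall x i, `|x - p| < r -> `|X i x| <= M) ->
  forall x i, `|x - p| < r -> `|X i x| <= M / 2.
Proof.
move=> e0 er r2 rrho eK X0 XM q i qr; have [j ji] := exists_neq_ord i n1.
have M0 : 0 <= M by exact: le_trans (normr_ge0 _) (XM q i qr).
(* The bound is 2 |w| (K |w| M), with |w| <= r + e <= 3 e. The combination of components vanishes at
   p', where X does. *)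
have main p' : `|p' - p| < e ->
    `|(q - p') 0 j * X i q - (q - p') 0 i * X j q| <= 18 * e ^+ 2 * K * M.
  move=> p'e; set w := q - p'.
  have w3 : `|w| <= 3 * e.
    have -> : w = (q - p) - (p' - p) by rewrite /w opprB addrA subrK.
    apply: le_trans (ler_normB _ _) _; apply: ltW.
    by apply: lt_le_trans (ltrD qr p'e) _; lra.
  have inb t : 0 <= t <= 1 -> `|p' + t *: w - p| < r.
    by move=> t01; apply: segment_in_ball => //; exact: lt_le_trans p'e er.
  pose f : vec -> R^o := (w 0 j \*: X i) - (w 0 i \*: X j).
  have df x : `|x - p| < r -> is_derive x w f (w 0 j * 'D_w (X i) x - w 0 i * 'D_w (X j) x).
    move=> xr; have dk k : is_derive x w (X k) ('D_w (X k) x).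
      by apply/derivableP/dX; exact: lt_le_trans xr rrho.
    exact: is_deriveB.
  have [t t01|t t01 e1] := @mean_value R _ f p' w; first by have [] := df _ (inb t t01).
  have tr : `|p' + t *: w - p| < r by apply: inb; case/andP: t01 => *; rewrite !ltW.
  have fE z : f z = w 0 j * X i z - w 0 i * X j z by [].
  have fp' : f p' = 0 by rewrite fE !X0// !mulr0 subrr.
  rewrite -fE.
  have -> : q = p' + w by rewrite /w subrKC.
  rewrite -[f _]subr0 -fp' e1 (@derive_val _ _ _ _ _ _ _ (df _ tr)).
  have [l lP] := @hX _ w (lt_le_trans tr rrho).
  set x := p' + t *: w in tr lP *.
  have XMx k : `|X k x| <= M by exact: XM.
  (* The unknown multiplier cancels, since l w_i w_j occurs in both terms. *)
  have -> : w 0 j * 'D_w (X i) x - w 0 i * 'D_w (X j) x =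
      w 0 j * ('D_w (X i) x - l * w 0 i) - w 0 i * ('D_w (X j) x - l * w 0 j).
    by move: ('D_w _ _) ('D_w _ _) => a b; ring.
  have b k k' : `|w 0 k * ('D_w (X k') x - l * w 0 k')| <= 9 * e ^+ 2 * K * M.
    rewrite normrM.
    apply: (@le_trans _ _ (3 * e * (K * (3 * e) * M))); last by rewrite le_eqVlt; apply/orP; left; apply/eqP; ring.
    apply: ler_pM => //; first exact: le_trans (coord_le w k) w3.
    apply: le_trans (lP k' M XMx) _.
    by apply: ler_wpM2r => //; exact: ler_wpM2l.
  apply: le_trans (ler_normB _ _) _; apply: le_trans (lerD (b j i) (b i j)) _.
  by rewrite le_eqVlt; apply/orP; left; apply/eqP; ring.
have e1 : `|p - p| < e by rewrite subrr normr0.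
(* The base points p and p + (e/2) e_j differ only in coordinate j, so subtracting their two
   estimates isolates (e/2) X_i(q). *)
have e2 : `|p + (e / 2) *: (basis_vec j : vec) - p| < e.
  rewrite addrC addKr normrZ gtr0_norm ?divr_gt0//.
  apply: le_lt_trans (ler_wpM2l _ (basis_norm_le1 j)) _; first by rewrite divr_ge0// ltW.
  by rewrite mulr1 ltr_pdivrMr// ltr_pMr// ltr1n.
have h1 := main p e1; have h2 := main _ e2.
have : `|e / 2 * X i q| <= 36 * e ^+ 2 * K * M.
  have -> : e / 2 * X i q = ((q - p) 0 j * X i q - (q - p) 0 i * X j q) -
    ((q - (p + (e / 2) *: basis_vec j)) 0 j * X i q
     - (q - (p + (e / 2) *: basis_vec j)) 0 i * X j q).
    rewrite !mxE !eqxx eq_sym (negPf ji) /=; move: (X i q) (X j q) => a b; ring.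
  apply: le_trans (ler_normB _ _) _; apply: le_trans (lerD h1 h2) _.
  by rewrite le_eqVlt; apply/orP; left; apply/eqP; ring.
rewrite normrM (gtr0_norm (divr_gt0 e0 (ltr0Sn _ 1))) => h3.
have : e / 2 * `|X i q| <= e / 2 * (M / 2).
  apply: le_trans h3 _.
  (* Origin of 144: halving M costs a factor 4 on top of 36. *)
  have -> : 36 * e ^+ 2 * K * M = e / 2 * (M / 2) * (144 * e * K) by field.
  by apply: ler_piMr => //; rewrite !mulr_ge0// ?invr_ge0// ltW.
by rewrite ler_pM2l// divr_gt0.
Qed.

(** Repeated halving bounds |X| by M / 2^k for every k, so X vanishes on the ball of radius [r]. *)
Lemma continuation_double (e r M : R) : 0 < e -> e <= r -> r <= 2 * e -> r <= rho ->
  144 * e * K <= 1 ->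
  (forall x i, `|x - p| < e -> X i x = 0) ->
  (forall x i, `|x - p| < r -> `|X i x| <= M) ->
  forall x i, `|x - p| < r -> X i x = 0.
Proof.
move=> e0 er r2 rrho eK X0 XM.
have XMk k x i : `|x - p| < r -> `|X i x| <= M / 2 ^+ k.
  elim: k x i => [|k IH] x i xr; first by rewrite expr0 divr1; exact: XM.
  rewrite exprSr invfM mulrA.
  exact: (continuation_step e0 er r2 rrho eK X0 IH).
move=> x i xr; apply/eqP; rewrite -normr_le0; apply/ler_addgt0Pr => d d0.
have M0 : 0 <= M by exact: le_trans (normr_ge0 _) (XM x i xr).
rewrite add0r; pose k := Num.bound (M / d).
apply: le_trans (XMk k x i xr) _.
rewrite ler_pdivrMr ?exprn_gt0// mulrC -ler_pdivrMr//.
apply: le_trans (ltW (archi_boundP _)) _; first by rewrite divr_ge0// ltW.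
by rewrite -natrX ler_nat ltnW// ltn_expl.
Qed.

(** The zero ball is doubled until it reaches radius [rho]: the radii are min(rho, 2^k e), and 144
    rho K <= 1 permits every doubling on the way. *)
Lemma unique_continuation (e M : R) : 0 < e -> 144 * rho * K <= 1 ->
  (forall x i, `|x - p| < e -> X i x = 0) ->
  (forall x i, `|x - p| < rho -> `|X i x| <= M) ->
  forall x i, `|x - p| < rho -> X i x = 0.
Proof.
move=> e0 rhoK X0 XM.
have [rho0|rho0] := leP rho 0.
  by move=> x i /lt_le_trans/(_ rho0); rewrite ltNge normr_ge0.
pose r k : R := Num.min rho (2 ^+ k * e).
have zero k x i : `|x - p| < r k -> X i x = 0.
  elim: k x i => [|k IH] x i xr.
    by apply: X0; move: xr; rewrite /r expr0 mul1r lt_min => /andP[].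
  have rk0 : 0 < r k by rewrite lt_min rho0 mulr_gt0// exprn_gt0.
  have rk : r k <= rho by rewrite ge_min lexx.
  have rS : r k.+1 <= rho by rewrite ge_min lexx.
  apply: (continuation_double rk0 _ _ rS _ IH (M := M)) xr => //.
  - rewrite le_min rk ge_min; apply/orP; right.
    by rewrite ler_pM2r// ler_weXn2l// ler1n.
  - rewrite /r exprS -mulrA [in leRHS]minEle; case: ifP => _; rewrite ge_min.
      by apply/orP; left; lra.
    by rewrite lexx orbT.
  - apply: le_trans rhoK; rewrite ler_wpM2r// ler_wpM2l//.
  - by move=> z j zr; apply: XM; exact: lt_le_trans zr rS.
move=> x i xr; apply: (zero (Num.bound (rho / e))); rewrite /r lt_min xr /=.
apply: lt_trans xr _; rewrite -ltr_pdivrMr//.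
apply: lt_trans (archi_boundP _) _; first by rewrite divr_ge0// ltW.
by rewrite -natrX ltr_nat ltn_expl.
Qed.

End UniqueContinuation.

(** * Propagation of local constancy inside a chart *)

Section ChartPropagation.
Context {R : realType} {n : nat}.
Notation vec := 'rV[R]_n.
Hypothesis n1 : (1 < n)%N.
Variable C : set vec.
Hypothesis oC : open C.
Variable p : vec -> R.
Hypothesis sp : smooth_on C (p : vec -> R^o).

Lemma constant_on_ball x (r : R) : (forall z, `|z - x| < r -> C z) ->
  (forall z i, `|z - x| < r -> d1 i p z = 0) ->
  forall z, `|z - x| < r -> p z = p x.
Proof.
move=> xC dp z zx; apply/eqP; rewrite -subr_eq0; apply/eqP.
have r0 : `|x - x| < r by rewrite subrr normr0; exact: le_lt_trans (normr_ge0 _) zx.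
have inb t : 0 <= t <= 1 -> `|x + t *: (z - x) - x| < r.
  by move=> t01; exact: segment_in_ball.
have := @mean_value R _ (p : vec -> R^o) x (z - x); rewrite subrKC.
have Cb t : 0 <= t <= 1 -> C (x + t *: (z - x)) by move=> /inb/xC.
case=> [t /Cb Ct|t t01 ->]; first exact: smooth_on_derivable sp Ct.
have t01' : 0 <= t <= 1 by case/andP: t01 => *; rewrite !ltW.
rewrite (derive_basis _ oC sp (Cb t t01')) big1// => i _.
by rewrite [X in _ * X](dp _ i (inb t t01')) mulr0.
Qed.

Variable L : vec -> vec -> R.
Hypothesis sL : smooth2 C L.
Hypothesis pL : forall x y u, C x -> y != 0 -> u != 0 -> 0 < inner L x y u u.
Hypothesis mob : forall x y h v, C x -> y != 0 -> schwarzian L p x y h v = 0.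

(** Coefficients of D_h X = l h + B(X, h). The first term comes from the y-derivatives hidden in
    [delta], rewritten by the vertical equation; the second from the connection. The last absorbs
    the quadratic term g(X, h) X, so [B] itself contains X. *)
Let B i k m (x y : vec) : R :=
  - (\sum_(j < n) Ncoef L j k x y * Ccoef L i m j x y) - Gam L i m k x y
  + (m == i)%:R * \sum_(a < n) g_ L a k x y * gradc L p a x y.

Let B_smooth i k m : smooth2 C (B i k m).
Proof.
apply: (smooth2D oC); first apply: (smooth2B oC).
- apply: (smooth2N oC); apply: (smooth2_sum oC) => j; apply: (smooth2M oC).
    exact/smooth2_dy/(smooth2_spray oC sL pL).
  exact: smooth2_Ccoef.
- exact: smooth2_Gam.
apply: (smooth2Z oC); apply: (smooth2_sum oC) => a.
exact: (smooth2M oC (smooth2_g oC sL _ _) (smooth2_grad oC sL pL _ sp)).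
Qed.

(* The horizontal equation in the form D_h X = l h + B(X, h). *)
Lemma derive_gradc x y h : C x -> y != 0 -> exists l : R, forall i,
  'D_h (fun x => gradc L p i x y : R^o) x - l * h 0 i =
  \sum_(k < n) \sum_(m < n) h 0 k * gradc L p m x y * B i k m x y.
Proof.
move=> Cx y0; exists (n%:R^-1 * (laplacian L p x y - grad_sqnorm L p x y)) => i.
have := schwarzian_horizontal i (mob h 0 Cx y0).
have sX := smooth2_left y0 (smooth2_grad oC sL pL i sp).
rewrite (derive_basis _ oC sX Cx).
set lam := n%:R^-1 * _; move: lam => lam e.
have innerE : inner L x y (grad L p x y) h =
    \sum_(k < n) h 0 k * \sum_(a < n) g_ L a k x y * gradc L p a x y.
  rewrite /inner exchange_big/=; apply: eq_bigr => k _; rewrite mulr_sumr.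
  by apply: eq_bigr => a _; rewrite -/(gradc L p a x y); ring.
rewrite innerE in e.
have dyE k : dy k (gradc L p i) x y = - \sum_(m < n) Ccoef L i m k x y * gradc L p m x y.
  exact: schwarzian_vertical (mob 0 (basis_vec k) Cx y0).
have dE k : delta L k (gradc L p i) x y = dx k (gradc L p i) x y
    + \sum_(m < n) (\sum_(j < n) Ncoef L j k x y * Ccoef L i m j x y) * gradc L p m x y.
  rewrite /delta; congr (_ + _).
  under eq_bigr do rewrite dyE mulrN mulr_sumr.
  rewrite sumrN opprK exchange_big/=; apply: eq_bigr => m _.
  by rewrite mulr_suml; apply: eq_bigr => j _; rewrite mulrA.
have Be k : \sum_(m < n) h 0 k * gradc L p m x y * B i k m x y =
   h 0 k * (\sum_(a < n) g_ L a k x y * gradc L p a x y) * gradc L p i x y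
   - h 0 k * (\sum_(m < n) (\sum_(j < n) Ncoef L j k x y * Ccoef L i m j x y) * gradc L p m x y
      + \sum_(m < n) Gam L i m k x y * gradc L p m x y).
  set S := \sum_(a < n) g_ L a k x y * _.
  have -> : h 0 k * S * gradc L p i x y =
      \sum_(m < n) h 0 k * gradc L p m x y * ((m == i)%:R * S).
    rewrite (bigD1 i)//= big1 => [|m /negPf mi]; first by rewrite eqxx mul1r addr0; ring.
    by rewrite mi mul0r mulr0.
  rewrite -big_split/= mulr_sumr -sumrB; apply: eq_bigr => m _.
  by rewrite /B -/S; ring.
rewrite (eq_bigr _ (fun k _ => Be k)) sumrB -mulr_suml.
have -> : \sum_(k < n) h 0 k * 'D_(basis_vec k) (fun x => gradc L p i x y : R^o) x =
    \sum_(k < n) h 0 k * (delta L k (gradc L p i) x y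
      + \sum_(j < n) Gam L i j k x y * gradc L p j x y)
  - \sum_(k < n) h 0 k * (\sum_(m < n) (\sum_(j < n) Ncoef L j k x y * Ccoef L i m j x y) * gradc L p m x y
      + \sum_(m < n) Gam L i m k x y * gradc L p m x y).
  rewrite -sumrB; apply: eq_bigr => k _; rewrite dE -mulrBr; congr (_ * _).
  rewrite -[LHS]/(dx k (gradc L p i) x y).
  by move: (dx _ _ _ _) (\sum_m _) (\sum_j _) => a b c; ring.
by rewrite e; move: (\sum_(k < n) _ * _) (\sum_(k < n) _ * _) => a b; ring.
Qed.

Lemma le_sum_nneg (I : finType) (f : I -> R) i : (forall j, 0 <= f j) -> f i <= \sum_j f j.
Proof. by move=> f0; rewrite (bigD1 i)//= lerDl sumr_ge0. Qed.

(** A smooth majorant of the absolute value: it makes the bounds [b] and [s] in [propagation]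
    continuous functions. *)
Lemma norm_le_sq (a : R) : `|a| <= 1 + a * a.
Proof.
rewrite -[a * a]ger0_norm -?expr2 ?sqr_ge0// normrX.
by have := normr_ge0 a; nra.
Qed.

(** The radius depends on [xb] alone and not on the point [z] where p is locally constant; this
    uniformity is what makes the set of such points closed. *)
Lemma propagation xb : C xb -> exists2 r : R, 0 < r &
  forall z, `|z - xb| < r -> (\forall x \near z, p x = p z) ->
  forall x, `|x - xb| < r -> p x = p xb.
Proof.
move=> Cxb.
have [i0] : exists i : 'I_n, true by exists (Ordinal (ltn_trans (ltn0Sn 0) n1)).
(* Reading the gradient at one fixed nonzero y turns it into a vector field on the chart. *)
pose y : vec := basis_vec i0 => _.
have y0 : y != 0.
  by apply/eqP => /rowP/(_ i0)/eqP; rewrite !mxE !eqxx oner_eq0.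
pose X i (x : vec) : R^o := gradc L p i x y.
have sX i : smooth_on C (X i) := smooth2_left y0 (smooth2_grad oC sL pL i sp).
pose b (x : vec) : R := \sum_(i < n) \sum_(k < n) \sum_(m < n) (1 + B i k m x y * B i k m x y).
pose s (x : vec) : R := \sum_(i < n) (1 + X i x * X i x).
have sb : smooth_on C (b : vec -> R^o).
  have sB i k m : smooth_on C (fun x => 1 + B i k m x y * B i k m x y : R^o).
    have sBy : smooth_on C (fun x => B i k m x y : R^o) := smooth2_left y0 (B_smooth i k m).
    exact: (smooth_onD oC (@smooth_on_cst R vec C 1) (smooth_onM oC sBy sBy)).
  apply: (smooth_on_sum oC) => i; apply: (smooth_on_sum oC) => k.
  by apply: (smooth_on_sum oC) => m; exact: sB.
have ss : smooth_on C (s : vec -> R^o).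
  have sXX i : smooth_on C (fun x => 1 + X i x * X i x : R^o).
    exact: (smooth_onD oC (@smooth_on_cst R vec C 1) (smooth_onM oC (sX i) (sX i))).
  by apply: (smooth_on_sum oC) => i; exact: sXX.
have [r1 r10 P1] := near_points oC Cxb (smooth_on_continuous sb Cxb) ltr01.
have [r2 r20 P2] := near_points oC Cxb (smooth_on_continuous ss Cxb) ltr01.
have sq0 (a : R) : 0 <= 1 + a * a by rewrite -expr2 addr_ge0// sqr_ge0.
have b0 x : 0 <= b x by do 3 (apply: sumr_ge0 => ? _).
pose K := b xb + 1; pose M := s xb + 1.
have K0 : 0 < K by rewrite ltr_wpDl.
(* The halves keep the ball about any z with |z - xb| < rho inside both balls where bounds are
   known; the last entry yields 144 rho K <= 1. *)
pose rho := Num.min (Num.min (r1 / 2) (r2 / 2)) (144 * K)^-1.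
have rho0 : 0 < rho by rewrite !lt_min !divr_gt0//= invr_gt0 mulr_gt0.
have near2 z x : `|z - xb| < rho -> `|x - z| < rho -> `|x - xb| < r1 /\ `|x - xb| < r2.
  rewrite !lt_min => /andP[/andP[z1 z2] _] /andP[/andP[x1 x2] _].
  have -> : x - xb = (x - z) + (z - xb) by rewrite addrA subrK.
  split; apply: le_lt_trans (ler_normD _ _) _.
    by rewrite [r1]splitr; exact: ltrD.
  by rewrite [r2]splitr; exact: ltrD.
have bK x : `|x - xb| < r1 -> b x <= K.
  by move=> /P1[_]; rewrite ltr_norml => /andP[_ h]; rewrite /K; apply: ltW; rewrite -ltrBlDl.
have sM x : `|x - xb| < r2 -> s x <= M.
  by move=> /P2[_]; rewrite ltr_norml => /andP[_ h]; rewrite /M; apply: ltW; rewrite -ltrBlDl.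
have p_ball z : `|z - xb| < rho -> (\forall x \near z, p x = p z) ->
    forall x, `|x - z| < rho -> p x = p z.
  move=> zx pz.
  have Cz x : `|x - z| < rho -> C x by move=> /(near2 _ _ zx)[/P1[]].
  have /nbhs_ballP[e /= e0 eP] : \forall x \near z, forall i, X i x = 0.
    have /nbhs_ballP[e /= e0 eP] : \forall x \near z, C x /\ p x = p z.
      apply: filterI => //; apply: open_nbhs_nbhs; split => //.
      by apply: Cz; rewrite subrr normr0.
    (* Each point of the half ball has a ball of radius e/2 on which p is still constant, so its
       derivatives vanish there. *)
    apply/nbhs_ballP; exists (e / 2) => /=; first exact: divr_gt0.
    move=> x xz i; rewrite /X /gradc mxE big1// => j _.
    rewrite (_ : d1 j p x = 0) ?mulr0//.
    rewrite /d1 (@near_eq_derive _ _ _ _ (fun=> p z : R^o)) ?derive_cst//.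
    apply/nbhs_ballP; exists (e / 2) => /=; first exact: divr_gt0.
    move=> w xw; have [|//] := eP w; rewrite (splitr e).
    exact: ball_triangle xz xw.
  have X0 : forall x i, `|x - z| < rho -> X i x = 0.
    apply: (@unique_continuation R n n1 X z rho K (ltW K0) _ _ e M e0).
    - move=> x h i /Cz Cx; exact: smooth_on_derivable (sX i) Cx.
    - move=> x h xz; have [xr1 xr2] := near2 _ _ zx xz.
      have [l lP] := derive_gradc h (Cz x xz) y0; exists l => i M' XM'.
      have M'0 : 0 <= M' by exact: le_trans (normr_ge0 _) (XM' i).
      rewrite [X in `|X|]lP; apply: le_trans (ler_norm_sum _ _ _) _.
      apply: (@le_trans _ _ (\sum_(k < n) \sum_(m < n) `|h| * M' * (1 + B i k m x y * B i k m x y))).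
        apply: ler_sum => k _; apply: le_trans (ler_norm_sum _ _ _) _.
        apply: ler_sum => m _; rewrite !normrM.
        apply: ler_pM (norm_le_sq _); [by rewrite mulr_ge0 ?normr_ge0|exact: normr_ge0|].
        by apply: ler_pM (coord_le h k) (XM' m); exact: normr_ge0.
      under eq_bigr do rewrite -mulr_sumr.
      rewrite -mulr_sumr (_ : K * `|h| * M' = `|h| * M' * K); last by ring.
      apply: ler_wpM2l; first exact: mulr_ge0.
      apply: le_trans (bK x xr1).
      apply: (le_sum_nneg (f := fun i => \sum_(k < n) \sum_(m < n) (1 + B i k m x y * B i k m x y))).
      by move=> j; do 2 (apply: sumr_ge0 => ? _).
    - by rewrite mulrAC -ler_pdivlMl ?mulr_gt0// mulr1 ge_min lexx orbT.
    - by move=> x i xz; apply: eP; rewrite -ball_normE /= distrC.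
    - move=> x i xz; have [_ xr2] := near2 _ _ zx xz.
      apply: le_trans (norm_le_sq _) _; apply: le_trans (sM x xr2).
      by apply: (le_sum_nneg (f := fun i => 1 + X i x * X i x)).
  apply: constant_on_ball => // x i xz.
  rewrite -(g_grad pL p i (Cz x xz) y0) big1// => j _.
  by rewrite [X in _ * X](X0 x j xz) mulr0.
(* Two passes: about z, p is constant on a ball containing xb, hence locally constant at xb; then
   the argument is repeated about xb. *)
exists rho => // z zx pz x xx.
have pz1 := p_ball z zx pz.
have xbz : `|xb - z| < rho by rewrite distrC.
have xbxb : `|xb - xb| < rho by rewrite subrr normr0.
apply: (p_ball xb xbxb _ x xx); rewrite (pz1 xb xbz).
apply/nbhs_ballP; exists (rho - `|xb - z|); first by rewrite /= subr_gt0.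
move=> w; rewrite -ball_normE /= => wx; apply: pz1.
have -> : w - z = (xb - z) - (xb - w) by rewrite opprB [RHS]addrC addrA subrK.
by apply: le_lt_trans (ler_normB _ _) _; rewrite -ltrBrDl.
Qed.

(** If p is not locally constant at [xb], points with dp <> 0 accumulate there; independence of y
    holds at them and passes to the limit with y and z fixed. *)
Lemma g_y_independent_at xb k l y z :
  (forall x y (t : R), C x -> 0 < t -> L x (t *: y) = t * L x y) ->
  C xb -> ~ (\forall x \near xb, p x = p xb) ->
  y != 0 -> z != 0 -> g_ L k l xb y = g_ L k l xb z.
Proof.
move=> hL Cxb npc y0 z0.
have sg u : u != 0 -> smooth_on C (fun x => g_ L k l x u : R^o).
  by move=> u0; exact: smooth2_left u0 (smooth2_g oC sL k l).
apply: (@eq_of_near R vec (fun x => g_ L k l x y) (fun x => g_ L k l x z)).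
- exact: smooth_on_continuous (sg y y0) Cxb.
- exact: smooth_on_continuous (sg z z0) Cxb.
move=> r r0; have [r1 r10 P1] := nbhs_radius oC Cxb.
have rr : 0 < Num.min r r1 by rewrite lt_min r0.
have [x xr [i dpx]] : exists2 x, `|x - xb| < Num.min r r1 & exists i, d1 i p x != 0.
  apply: contrapT => nx; apply: npc; apply/nbhs_ballP; exists (Num.min r r1) => //= x.
  rewrite -ball_normE /= distrC => xr.
  apply: (constant_on_ball (r := Num.min r r1)) xr => [w|w j wr].
    by rewrite lt_min => /andP[_ /P1].
  by apply/eqP/negPn/negP => dw; apply: nx; exists w => //; exists j.
move: xr; rewrite lt_min => /andP[xr /P1 Cx].
exists x, x; split; [exact: xr|exact: xr|].
apply: (g_y_independent oC sL pL hL Cx sp _ n1 _ k l y0 z0); last by exists i.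
by move=> u j u0; exact: mob.
Qed.

End ChartPropagation.

(** * Ellipsoids and the low-dimensional cases *)

Section LinearAlgebra.
Context {R : realType}.

Definition posdef n (G : 'M[R]_n) := forall u : 'rV[R]_n, u != 0 -> 0 < (u *m G *m u^T) 0 0.

(** Induction on the size through the Schur complement S = D - b^T b / a; the factor P is lower
    triangular by blocks. *)
Lemma cholesky n (G : 'M[R]_n) : G^T = G -> posdef G ->
  exists2 P : 'M[R]_n, P \in unitmx & G = P *m P^T.
Proof.
elim: n G => [|n IH] G Gsym Gpos.
  by exists 1%:M; [exact: unitmx1|rewrite [LHS]flatmx0 [RHS]flatmx0].
move: G Gsym Gpos; rewrite -[n.+1]/(1 + n)%N => G Gsym Gpos.
pose a := G 0 0; pose b : 'rV[R]_n := ursubmx G; pose D : 'M[R]_n := drsubmx G.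
have aE : ulsubmx G = a%:M.
  by rewrite [LHS]mx11_scalar mxE mxE; congr (G _ _)%:M; apply/val_inj.
have GE : G = block_mx a%:M b b^T D.
  by rewrite -[LHS]submxK aE; congr block_mx; rewrite -[in LHS]Gsym trmx_ursub.
have Dsym : D^T = D by rewrite /D trmx_drsub Gsym.
have a0 : 0 < a.
  have := Gpos (row_mx 1 0); rewrite GE mul_row_block tr_row_mx mul_row_col.
  rewrite !mul0mx !addr0 trmx0 mulmx0 addr0 trmx1 mulmx1 mul1mx mxE eqxx mulr1n.
  apply; apply/eqP => /rowP/(_ (lshift n 0)).
  by rewrite row_mxEl !mxE eqxx => /eqP; rewrite oner_eq0.
pose S := D - a^-1 *: (b^T *m b).
have Ssym : S^T = S by rewrite /S linearB linearZ /= trmx_mul trmxK Dsym.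
have Spos : posdef S.
  (* Completing the square: this [c] makes the first block of (c, u) G vanish, leaving u S. *)
  move=> u u0; pose c : 'M[R]_1 := - (a^-1 *: (u *m b^T)).
  have := Gpos (row_mx c u).
  have -> : row_mx c u *m G = row_mx 0 (u *m S).
    rewrite GE mul_row_block; congr row_mx.
      by rewrite mul_mx_scalar /c scalerN scalerA divff ?gt_eqF// scale1r addNr.
    by rewrite /c /S mulmxBr mulNmx -scalemxAl -scalemxAr -mulmxA addrC.
  rewrite tr_row_mx mul_row_col mul0mx add0r; apply.
  by apply: contraNneq u0 => /(congr1 rsubmx); rewrite row_mxKr => ->; rewrite linear0.
have [P Pu SE] := IH S Ssym Spos.
pose s := Num.sqrt a.
have s0 : s != 0 by rewrite gt_eqF// sqrtr_gt0.
have ss : s * s = a by rewrite -expr2 sqr_sqrtr// ltW.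
exists (block_mx s%:M 0 (s^-1 *: b^T) P).
  by rewrite unitmxE det_lblock det_scalar1 unitrM unitfE s0 -unitmxE.
rewrite GE tr_block_mx mulmx_block; congr block_mx.
- by rewrite mul0mx addr0 tr_scalar_mx -scalar_mxM ss.
- by rewrite mul0mx addr0 linearZ /= trmxK mul_scalar_mx scalerA divff// scale1r.
- by rewrite trmx0 mulmx0 addr0 tr_scalar_mx mul_mx_scalar scalerA divff// scale1r.
- rewrite linearZ /= trmxK -scalemxAl -scalemxAr scalerA -invfM ss -SE /S.
  by rewrite addrC subrK.
Qed.

Lemma lipschitz_continuous (V W : normedModType R) (f : V -> W) (K : R) : 0 <= K ->
  (forall x y, `|f x - f y| <= K * `|x - y|) -> continuous f.
Proof.
move=> K0 fK x; apply/cvgrPdist_lt => e e0.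
have K1 : 0 < K + 1 by rewrite ltr_wpDl.
apply/nbhs_ballP; exists (e / (K + 1)); first exact: divr_gt0.
move=> z; rewrite -ball_normE /= => xz; apply: le_lt_trans (fK x z) _.
apply: (@le_lt_trans _ _ ((K + 1) * `|x - z|)); first by rewrite ler_wpM2r// lerDl.
by rewrite mulrC -ltr_pdivlMr.
Qed.

Lemma mulmxr_continuous n (P : 'M[R]_n) : continuous (fun y : 'rV[R]_n => y *m P).
Proof.
pose K : R := \sum_(j < n) \sum_(k < n) `|P k j|.
have K0 : 0 <= K by do 2 (apply: sumr_ge0 => ? _).
apply: (@lipschitz_continuous 'rV[R]_n 'rV[R]_n _ K K0) => y z; rewrite -mulmxBl mulrC.
rewrite [leLHS]/Num.Def.normr/= mx_normrE bigmax_le ?mulr_ge0// => -[a j] _.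
rewrite ord1 mxE; apply: le_trans (ler_norm_sum _ _ _) _.
apply: (@le_trans _ _ (`|y - z| * \sum_(k < n) `|P k j|)).
  rewrite mulr_sumr; apply: ler_sum => k _; rewrite normrM ler_wpM2r//.
  exact: coord_le.
apply: ler_wpM2l => //.
by apply: (le_sum_nneg (f := fun j => \sum_(k < n) `|P k j|)) => ?; exact: sumr_ge0.
Qed.

End LinearAlgebra.

Section LocallyConstant.
Context {R : realType} {V W : normedModType R}.

Definition locally_constant (U : set V) (f : V -> W) :=
  forall x, U x -> \forall z \near x, f z = f x.

Lemma derive_locally_constant (f : V -> W) x v :
  (\forall z \near x, f z = f x) -> 'D_v f x = 0.
Proof.
by move=> fx; rewrite (@near_eq_derive _ _ _ f (fun=> f x) _ _ fx) derive_cst.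
Qed.

Lemma locally_constant_smooth (U : set V) (f : V -> W) : open U ->
  locally_constant U f -> smooth_on U f.
Proof.
move=> oU lf vs; suff /(_ vs) lvs : forall vs, locally_constant U (iter_deriv f vs).
  move=> x Ux; have fx := lvs x Ux; split=> [|v].
    apply: cvg_trans (near_eq_cvg _) _; last exact: (cvg_cst (iter_deriv f vs x)).
    by apply: filterS fx => z ->.
  apply: (@near_eq_derivable _ _ _ (fun=> iter_deriv f vs x)).
    by apply: filterS fx => z ->.
  exact: derivable_cst.
elim=> [//|v ws IH] x Ux /=.
have D0 z : U z -> 'D_v (iter_deriv f ws) z = 0 by move=> /IH/derive_locally_constant.
by apply: filterS (open_nbhs_nbhs (conj oU Ux)) => z Uz; rewrite !D0.
Qed.

End LocallyConstant.

Section Indicatrix.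
Context {R : realType}.

Lemma euclidE n (y u w : 'rV[R]_n) : euclid y u w = (u *m w^T) 0 0.
Proof. by rewrite mxE; apply: eq_bigr => i _; rewrite mxE. Qed.

Lemma unit_sphereE n (z : 'rV[R]_n) : unit_sphere z = (euclid 0 z z = 1).
Proof. by rewrite /unit_sphere /euclid /=; under eq_bigr do rewrite expr2. Qed.

Lemma innerE n (L : 'rV[R]_n -> 'rV[R]_n -> R) x y u w :
  inner L x y u w = (u *m (\matrix_(k < n, l < n) g_ L k l x y) *m w^T) 0 0.
Proof.
rewrite mxE /inner exchange_big/=; apply: eq_bigr => j _.
rewrite !mxE mulr_suml; apply: eq_bigr => i _; rewrite mxE; ring.
Qed.

(** The linear map y -> y P sends the ellipsoid onto the sphere isometrically, so the conformal
    exponent is 0. *)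
Lemma ellipsoid_conformal n (A : set 'rV[R]_n) (gA : 'rV[R]_n -> 'rV[R]_n -> 'rV[R]_n -> R)
    (P : 'M[R]_n) : P \in unitmx ->
  (forall y, A y <-> euclid 0 (y *m P) (y *m P) = 1) ->
  (forall y u w, A y -> gA y u w = euclid 0 (u *m P) (w *m P)) ->
  conformally_diffeomorphic A gA unit_sphere euclid.
Proof.
move=> Pu AP gAP.
have lin (Q : 'M[R]_n) (t : R) (v x : 'rV[R]_n) : (t *: v + x) *m Q = t *: (v *m Q) + x *m Q.
  by rewrite mulmxDl scalemxAl.
exists [set: _], [set: _], (fun y => y *m P), (fun z => z *m invmx P), (fun=> 0).
split.
- split=> //; first exact: openT.
    by apply: smooth_on_linear; [exact: mulmxr_continuous|exact: lin].
  exact: smooth_on_cst.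
- split=> //; first exact: openT.
  by apply: smooth_on_linear; [exact: mulmxr_continuous|exact: lin].
- by move=> y /AP yP; rewrite unit_sphereE mulmxK.
- by move=> z; rewrite unit_sphereE => z1; rewrite mulmxKV//; split=> //; apply/AP; rewrite mulmxKV.
- move=> y u w Ay _ _; rewrite expR0 mul1r gAP// !(@derive_val _ _ _ _ _ _ _ (is_derive_linear _ _ (lin P))).
  by rewrite !euclidE.
Qed.

End Indicatrix.

(** * The indicatrix in dimension one *)

Section LowDimension.
Context {R : realType}.
Notation vec := 'rV[R]_1.

Let e : vec := const_mx 1.
Let pos (y : vec) : bool := 0 < y 0 0.

Let neq0E (y : vec) : (y != 0) = (y 0 0 != 0).
Proof.
congr negb; apply/eqP/eqP => [->|y0]; first by rewrite mxE.
by apply/rowP => j; rewrite !ord1 mxE.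
Qed.

Let pos_near (y : vec) : y != 0 -> \forall z \near y, pos z = pos y.
Proof.
rewrite neq0E => y0.
have yc : {for y, continuous (fun z : vec => z 0 0 : R^o)} by exact: coord_continuous.
have yy : 0 < `|y 0 0| by rewrite normr_gt0.
have [r r0 rP] := near_points openT (I : [set: vec] y) yc yy.
apply/nbhs_ballP; exists r => // z; rewrite -ball_normE /= distrC => /rP[_].
rewrite /pos ltr_norml; case: (ltgtP (y 0 0) 0) y0 => // y0 _.
  rewrite (ltr0_norm y0) => /andP[_ zy]; apply/negbTE; rewrite -leNgt.
  by move: zy; rewrite ltrBlDr addNr => /ltW.
by rewrite (gtr0_norm y0) => /andP[+ _]; rewrite ltrBrDl subrr.
Qed.

Let comp_pos (a b : vec) : locally_constant [set y : vec | y != 0] (fun y => if pos y then a else b).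
Proof. by move=> y /= /pos_near; apply: filterS => z ->. Qed.

(** The indicatrix has one point on each half-line and S^0 is {1, -1}. Maps constant on each
    half-line are smooth off 0, and tangent vectors of the indicatrix are zero. *)
Lemma conformal_dimension1 (L : vec -> R) (gA : vec -> vec -> vec -> R) :
  (forall t y, 0 < t -> L (t *: y) = t * L y) ->
  (forall y, y != 0 -> 0 < L y) ->
  (forall y w, gA y 0 w = 0) ->
  conformally_diffeomorphic [set y | L y = 1] gA unit_sphere euclid.
Proof.
move=> hL L0 gA0.
have e0 : e != 0 by rewrite neq0E mxE oner_eq0.
have e0' : - e != 0 by rewrite oppr_eq0.
have A0 y : L y = 1 -> y != 0.
  move=> Ly; apply/eqP => y0; have := hL 2 0 (ltr0Sn _ 1).
  by move: Ly; rewrite y0 scaler0; lra.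
pose h (y : vec) : vec := if pos y then e else - e.
(* [L] need not be even, so each half-line has its own normalization. *)
pose k (y : vec) : vec := if pos y then (L e)^-1 *: e else (L (- e))^-1 *: - e.
have kh y : L y = 1 -> k (h y) = y.
  move=> Ly; have := A0 y Ly; rewrite neq0E /k /h => y0.
  have yE : y = y 0 0 *: e by apply/rowP => j; rewrite ord1 !mxE mulr1.
  case: (ltgtP (y 0 0) 0) y0 => // y0 _.
    have -> : pos y = false by rewrite /pos ltNge ltW.
    have -> : pos (- e) = false by rewrite /pos !mxE ltr0N1.
    have : - y 0 0 * L (- e) = 1 by rewrite -hL ?oppr_gt0// scaleNr scalerN opprK -yE.
    by move=> /mulr1_eq <-; rewrite invrK scaleNr scalerN opprK -yE.
  have -> : pos y = true by rewrite /pos y0.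
  have -> : pos e = true by rewrite /pos !mxE ltr01.
  have : y 0 0 * L e = 1 by rewrite -hL// -yE.
  by move=> /mulr1_eq <-; rewrite invrK -yE.
exists [set y | y != 0], [set y | y != 0], h, k, (fun=> 0); split.
- split=> //; first exact: open_neq0.
    exact/locally_constant_smooth/comp_pos/open_neq0.
  exact: smooth_on_cst.
- split; first exact: open_neq0.
    move=> z; rewrite unit_sphereE /euclid big_ord1 /= neq0E.
    by apply: contra_eq_neq => ->; rewrite mul0r eq_sym oner_eq0.
  exact/locally_constant_smooth/comp_pos/open_neq0.
- move=> y Ly; split; last exact: kh.
  by rewrite unit_sphereE /euclid big_ord1 /h; case: ifP => _; rewrite !mxE ?mulrNN mulr1.
- move=> z; rewrite unit_sphereE /euclid big_ord1 => z1.
  have zE : z = z 0 0 *: e by apply/rowP => j; rewrite ord1 !mxE mulr1.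
  have z11 : (z 0 0 == 1) || (z 0 0 == -1) by rewrite -eqf_sqr expr1n expr2 z1.
  have posZ (t : R) y : 0 < t -> pos (t *: y) = pos y.
    by move=> t0; rewrite /pos mxE pmulr_rgt0.
  case/orP: z11 => /eqP z00; rewrite /= zE z00.
    have pe : pos e = true by rewrite /pos mxE ltr01.
    have Le : 0 < (L e)^-1 by rewrite invr_gt0 L0.
    by rewrite scale1r /k pe hL// mulVf ?gt_eqF ?L0// /h posZ// pe.
  have pe : pos (- e) = false by rewrite /pos !mxE ltr0N1.
  have Le : 0 < (L (- e))^-1 by rewrite invr_gt0 L0.
  by rewrite scaleN1r /k pe hL// mulVf ?gt_eqF ?L0// /h posZ// pe.
- move=> y u w Ly [c [d [d0 sc cA c0 cu]]] _.
  have y0 := A0 y Ly.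
  have Dh v : 'D_v h y = 0 by exact/derive_locally_constant/comp_pos.
  have cc : {for 0, continuous (c : R^o -> vec)}.
    by have [] := sc [::] 0 _; rewrite //= in_itv /= oppr_lt0 d0.
  (* A curve in the indicatrix stays on one side of 0 for small t, and each side carries a single
     point: the curve is locally constant. *)
  have ct : \forall t \near (0 : R^o), c t = c 0.
    have ht : \forall t \near (0 : R^o), h (c t) = h y.
      by rewrite -c0 in y0 *; exact: cc (comp_pos _ _ y0).
    near=> t; have td : - d < t < d.
      have : `|t| < d by near: t; exact: (@nbhs0_lt R R d d0).
      by rewrite ltr_norml.
    rewrite c0 -(kh y Ly) -(kh _ (cA t td)); congr k; near: t; exact: ht.
  have -> : u = 0 by rewrite -cu derive1E; exact: derive_locally_constant ct.
  by rewrite gA0 mulr0 /euclid big_ord1 Dh mxE mul0r.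
Unshelve. all: by end_near. Qed.

End LowDimension.

(** * Propagation over the manifold *)

Section Global.
Context {R : realType} {n : nat} {M : smoothManifold R n}.
Variables (F Fbar : finslerStructure M) (f : M -> M) (phi : M -> R).

Definition flat_locus : set M := [set q | \forall q' \near q, phi q' = phi q].

Lemma connected_clopen (S : set M) q : open S -> open (~` S) -> S q -> S = setT.
Proof.
move=> oS cS Sq; apply: (@point_connected _ _ M S).
- by exists q.
- by exists S => //; rewrite setTI.
- by exists S; [rewrite -[S]setCK; exact: open_closedC|rewrite setTI].
Qed.

(** For a locally constant phi a level set and its complement are both open; connectedness
    concludes. *)
Lemma flat_locus_constant : flat_locus = setT -> forall q q', phi q' = phi q.
Proof.
move=> Sall q; suff : [set q' | phi q' = phi q] = setT by move=> e q'; have : [set: M] q' by []; rewrite -e.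
have oP (P : R -> Prop) : open [set q' | P (phi q')].
  rewrite openE => q' /= Pq'; have : flat_locus q' by rewrite Sall.
  by apply: filterS => z /= ->.
exact: (connected_clopen (oP (fun r => r = phi q)) (oP (fun r => r <> phi q)) (erefl _)).
Qed.

Lemma constant_homothetic : conformal F Fbar f phi -> (forall q q', phi q' = phi q) ->
  forall q : M, homothetic F Fbar f.
Proof.
move=> cf pc q; exists (phi q); suff <- : phi = fun=> phi q by [].
by apply/funext => q'; exact: pc.
Qed.

Hypothesis n1 : (1 < n)%N.
Hypothesis sphi : smooth_function phi.
Hypothesis mob : forall (i : idx M) (x y h v : 'rV[R]_n), img i x -> y != 0 ->
  schwarzian (F i) (phi \o param i) x y h v = 0.

Lemma finsler_smooth2 i : smooth2 (img i) (F i).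
Proof. exact: fs_smooth. Qed.

Arguments finsler_smooth2 : clear implicits.

(** Openness is formal. For closedness, [propagation] gives every point [b] a neighbourhood on which
    phi is constant as soon as it contains one flat point. *)
Lemma flat_locus_full q : flat_locus q -> flat_locus = setT.
Proof.
apply: connected_clopen.
  rewrite openE => z Sz; apply: filterS (nbhs_interior Sz) => w wz /=.
  have e := nbhs_singleton wz; apply: filterS wz => u /= ->.
  by rewrite e.
rewrite openE => b Sb; apply: contrapT => nb; apply: Sb.
have [i bi] := dom_cover b.
have bimg : img i (chart_map i b) by exists b.
have oC : open (img i) by exact: img_open.
have [r r0 rP] := propagation n1 oC (@sphi i) (finsler_smooth2 i)
  (fun x y u => @fs_posdef _ _ _ F i x y u) (@mob i) bimg.
pose N := [set w | dom i w /\ `|chart_map i w - chart_map i b| < r].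
have Nb : nbhs b N.
  apply: filterI; first exact: open_nbhs_nbhs (conj (dom_open i) bi).
  have /cvgrPdist_lt/(_ r r0) := chart_continuous bi.
  by apply: filterS => w; rewrite distrC.
(* Otherwise [N] misses the flat locus and [b] is interior to the complement. *)
have [s [Ss [si sr]]] : exists s, flat_locus s /\ N s.
  apply: contrapT => ns; apply: nb; apply: filterS Nb => w Nw Sw.
  by apply: ns; exists w.
have pK w : dom i w -> param i (chart_map i w) = w by exact: chartK.
have near_s : \forall x \near chart_map i s, (phi \o param i) x = (phi \o param i) (chart_map i s).
  have simg : img i (chart_map i s) by exists s.
  have h : nbhs (param i (chart_map i s)) [set u | phi u = phi s] by rewrite pK.
  by rewrite /= pK//; exact: (param_continuous simg h).
have ball_b := rP _ sr near_s.
apply: filterS Nb => w [wi wr].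
by have := ball_b _ wr; rewrite /= !pK.
Qed.

(** At a non-flat point g(x0, y) is one matrix G = P P^T, and F^2 = g(y, y) becomes |y P|^2: the
    indicatrix is an ellipsoid. *)
Lemma conformal_of_nonflat x0 i : dom i x0 -> ~ flat_locus x0 ->
  conformally_diffeomorphic
    (indicatrix F i x0) (indicatrix_metric F i x0) unit_sphere euclid.
Proof.
move=> ix0 nf; set xb := chart_map i x0.
have Cxb : img i xb by exists x0.
have oC : open (img i) by exact: img_open.
have sL := finsler_smooth2 i.
have pL x y u : img i x -> y != 0 -> u != 0 -> 0 < inner (F i) x y u u.
  exact: fs_posdef.
have hL x y (t : R) : img i x -> 0 < t -> F i x (t *: y) = t * F i x y.
  exact: fs_homogeneous.
have npc : ~ (\forall x \near xb, (phi \o param i) x = (phi \o param i) xb).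
  move=> pc; apply: nf.
  have h : \forall w \near x0, (phi \o param i) (chart_map i w) = (phi \o param i) xb.
    exact: (chart_continuous ix0 pc).
  have hd : \forall w \near x0, dom i w.
    exact: open_nbhs_nbhs (conj (dom_open i) ix0).
  apply: filterS (filterI h hd) => w [/= e wi].
  by move: e; rewrite !chartK.
have [y1 y10] : exists y : 'rV[R]_n, y != 0.
  have n0 : (0 < n)%N by exact: ltn_trans n1.
  exists (basis_vec (Ordinal n0)).
  by apply/eqP => /rowP/(_ (Ordinal n0))/eqP; rewrite !mxE !eqxx oner_eq0.
pose G := \matrix_(k < n, l < n) g_ (F i) k l xb y1.
have GE y : y != 0 -> \matrix_(k < n, l < n) g_ (F i) k l xb y = G.
  move=> y0; apply/matrixP => k l; rewrite [LHS]mxE [RHS]mxE.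
  exact: (g_y_independent_at n1 oC (@sphi i) sL pL (@mob i) k l hL Cxb npc y0 y10).
have gE y u w : y != 0 -> inner (F i) xb y u w = (u *m G *m w^T) 0 0.
  by move=> y0; rewrite innerE GE.
have Gsym : G^T = G.
  by apply/matrixP => k l; rewrite !mxE; exact: (g_sym oC sL Cxb).
have Gpos : posdef G by move=> u u0; rewrite -(gE y1)//; exact: pL.
have [P Pu PE] := cholesky Gsym Gpos.
have GP u w : (u *m G *m w^T) 0 0 = euclid 0 (u *m P) (w *m P).
  by rewrite euclidE PE trmx_mul !mulmxA.
(* Homogeneity at 0 keeps the origin off the indicatrix; the formulas for g and F^2 hold for y <> 0
   only. *)
have F0 : F i xb 0 = 0.
  have := hL xb 0 2 Cxb (ltr0Sn _ 1); rewrite scaler0 => e.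
  lra.
have sqE y : y != 0 -> F i xb y ^+ 2 = euclid 0 (y *m P) (y *m P).
  move=> y0; rewrite -GP -(gE y)// -[LHS]/(sq (F i) xb y) (euler_g oC sL hL Cxb y0).
  by [].
have A0 y : F i xb y = 1 -> y != 0.
  by apply: contra_eq_neq => ->; rewrite F0 eq_sym oner_eq0.
apply: (ellipsoid_conformal Pu) => [y|y u w Ay]; last first.
  by rewrite /indicatrix_metric gE ?GP//; exact: A0.
split=> [Fy|yP].
  by rewrite -sqE ?A0// Fy expr1n.
have y0 : y != 0.
  apply/eqP => y0; move: yP; rewrite y0 mul0mx euclidE mul0mx mxE => /eqP.
  by rewrite eq_sym oner_eq0.
move: yP; rewrite -sqE// => /eqP; rewrite -(expr1n _ 2).
by rewrite eqrXn2 ?ler01 ?fs_ge0// => /eqP.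
Qed.

End Global.

Theorem theorem1p3 (R : realType) (n : nat) (M : smoothManifold R n)
    (F : finslerStructure M)
    (hF : forward_complete F)
    (hmob : exists (Fbar : finslerStructure M) (f : M -> M),
        mobius F Fbar f /\ ~ homothetic F Fbar f)
    (x0 : M) (i : idx M) (hi : dom i x0) :
  conformally_diffeomorphic
    (indicatrix F i x0) (indicatrix_metric F i x0) unit_sphere euclid.
Proof.
have [Fbar [f [[phi [cf mob]] nh]]] := hmob.
have [_ sphi _] := cf.
case: n M F hF hmob x0 i hi Fbar f phi cf mob nh sphi => [|[|n]] M F hF hmob x0 i hi Fbar f phi cf mob nh sphi.
(* Dimension 0: both sets are empty, since F vanishes at the only vector and an empty sum is not
   1. *)
- have Cx : img i (chart_map i x0) by exists x0.
  apply: (@ellipsoid_conformal R 0 _ _ 1%:M); first exact: unitmx1.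
    move=> y; rewrite euclidE mxE big_ord0; split=> [|/eqP].
      rewrite /indicatrix /= => Fy.
      have := fs_homogeneous F 0 Cx (ltr0Sn _ 1).
      by move: Fy; rewrite (thinmx0 y) scaler0; lra.
    by rewrite eq_sym oner_eq0.
  by move=> y u w _; rewrite /indicatrix_metric /inner big_ord0 euclidE mxE big_ord0.
- have Cx : img i (chart_map i x0) by exists x0.
  have hL x y (t : R) : img i x -> 0 < t -> F i x (t *: y) = t * F i x y.
    exact: fs_homogeneous.
  apply: conformal_dimension1 => [t y t0|y y0|y w].
  + exact: hL.
  (* Positivity of F off 0: F is nonnegative and F^2 = g(y, y) > 0. *)
  + rewrite lt_neqAle (fs_ge0 _ _ Cx) andbT eq_sym -sqrf_eq0 gt_eqF//.
    rewrite -[X in 0 < X]/(sq (F i) (chart_map i x0) y).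
    have oC : open (img i) by exact: img_open.
    have sL : smooth2 (img i) (F i) by exact: finsler_smooth2.
    rewrite (euler_g oC sL hL Cx y0).
    exact: (@fs_posdef _ _ _ F i _ y y Cx y0 y0).
  + by rewrite /indicatrix_metric /inner big_ord1 big_ord1 mxE mulr0 mul0r.
(* Dimension at least 2: one flat point would make phi constant and f homothetic, so x0 is not
   flat. *)
- have n2 : (1 < n.+2)%N by [].
  apply: (conformal_of_nonflat n2 sphi mob hi) => fl; apply: nh.
  exact: constant_homothetic cf (flat_locus_constant (flat_locus_full n2 sphi mob fl)) x0.
Qed.
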